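(* Let $\omega:[0,\infty)\to[0,\infty)$ be a continuous, increasing, subadditive function with $\omega(0)=0$, such that $\log(1+t)\le c\,\omega(t)$ for all $t>1$ and some constant $c>0$, and $\int_0^\infty \frac{\omega(t)}{1+t^2}\,dt<\infty$. Let $p(z)=|\operatorname{Im} z|+\omega(|z|)$ for $z\in\mathbb{C}$. Then there exists a function $\tilde p$, subharmonic in $\mathbb{C}$, such that $$p(z)\simeq\tilde p(z)$$ and $$\frac{1}{\tilde p(z)}\lesssim \Delta\tilde p(z)\qquad\text{if } |\operatorname{Im} z|\le 2\omega(|z|).$$
   Context: Notation: $A\lesssim B$ means that $A\le cB$ for some constant $c>0$ (independent of $z$), and $A\simeq B$ means $A\lesssim B\lesssim A$. The Laplacian $\Delta\tilde p$ of the subharmonic function $\tilde p$ is taken in the distributional sense, so it is a positive measure; the last inequality is understood with respect to Lebesgue measure $dm$ on $\mathbb{C}$, i.e. on the set $\{z:|\operatorname{Im} z|\le 2\omega(|z|)\}$ a constant multiple of $\Delta\tilde p$ dominates $\frac{1}{\tilde p}\,dm$.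
   Formalization: The bound p̃ ≲ p is stated with one constant on each set |z| ≥ δ, δ > 0 (p̃ not depending on δ), rather than on all of ℂ, because p(0)=0 and uniform comparability down to z=0 fails for some admissible ω; all other bounds are kept on the full range. *)

(* Defs.v *)
From HB Require Import structures.
From mathcomp Require Import all_boot all_order all_algebra.
From mathcomp Require Import all_classical all_reals all_analysis.

Set Implicit Arguments.
Unset Strict Implicit.
Unset Printing Implicit Defensive.

Import Order.TTheory GRing.Theory Num.Theory.
Import numFieldNormedType.Exports.

Local Open Scope classical_set_scope.
Local Open Scope ring_scope.
Local Open Scope ereal_scope.

(** The complex plane is [R * R], with [z = (x, y)] standing for [x + i y]: the
    library has a topology, a sigma-algebra and a product Lebesgue measure on
    it. The library norm of [R * R] is the sup norm, hence [cmod]. *)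

Definition cmod (R : realType) (z : R * R) : R :=
  Num.sqrt (z.1 ^+ 2 + z.2 ^+ 2)%R.

Definition leb2 (R : realType) :
    {measure set (measurableTypeR R * measurableTypeR R) -> \bar R} :=
  @lebesgue_measure R \x @lebesgue_measure R.

Definition lesssim_on (R : realType) (D : set (R * R)) (f g : R * R -> R) : Prop :=
  exists2 c : R, (0 < c)%R & forall z, D z -> (f z <= c * g z)%R.

(** The function identically -oo is excluded. On the whole plane the sub-mean
    value inequality holds for every circle as soon as it holds for small ones. *)
Definition subharmonic (R : realType) (u : R * R -> \bar R) : Prop :=
  [/\ forall z, u z < +oo,
      exists z, u z != -oo,
      lower_semicontinuous (fun z => - u z) &
      forall (z : R * R) (r : R), (0 < r)%R ->
        u z <= ((2 * pi)^-1)%:E *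
               \int[lebesgue_measure]_(t in `[0%R, (2 * pi)%R])
                 u ((z.1 + r * cos t)%R, (z.2 + r * sin t)%R)].

Definition dx (R : realType) (f : R * R -> R) : R * R -> R :=
  fun z => 'D_((1, 0)%R : R * R) f z.

Definition dy (R : realType) (f : R * R -> R) : R * R -> R :=
  fun z => 'D_((0, 1)%R : R * R) f z.

Definition lapl (R : realType) (f : R * R -> R) : R * R -> R :=
  fun z => (dx (dx f) z + dy (dy f) z)%R.

Fixpoint Ck (R : realType) (k : nat) (f : R * R -> R) : Prop :=
  continuous f /\
  if k is k'.+1 then
    [/\ forall z, derivable f z ((1, 0)%R : R * R),
        forall z, derivable f z ((0, 1)%R : R * R),
        Ck k' (dx f) & Ck k' (dy f)]
  else True.

Definition test_function (R : realType) (phi : R * R -> R) : Prop :=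
  (forall k, Ck k phi) /\ compact (closure [set z | phi z != 0%R]).

(** The distribution [Delta u] is the locally finite measure [mu]; [u] is
    required to be locally integrable, so that the right-hand integral is never
    a default value. *)
Definition distr_laplacian (R : realType) (u : R * R -> \bar R)
    (mu : {measure set (measurableTypeR R * measurableTypeR R) -> \bar R}) :
    Prop :=
  [/\ forall K : set (R * R), compact K -> mu K < +oo,
      forall K : set (R * R), compact K -> (leb2 R).-integrable K u &
      forall phi : R * R -> R, test_function phi ->
        \int[mu]_z (phi z)%:E = \int[leb2 R]_z (u z * (lapl phi z)%:E)].

(* Main.v *)
Require Import Defs.
From HB Require Import structures.
From mathcomp Require Import all_boot all_order all_algebra.
From mathcomp Require Import all_classical all_reals all_analysis.
From mathcomp Require Import measurable_realfun.
From mathcomp Require Import ring lra.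

Set Implicit Arguments.
Unset Strict Implicit.
Unset Printing Implicit Defensive.

Import Order.TTheory GRing.Theory Num.Theory.
Import numFieldNormedType.Exports.

Local Open Scope classical_set_scope.
Local Open Scope ring_scope.

(** Idea. Put [w = omega^2], [<z> = sqrt (1 + |z|^2)] and let
    [T r = r^3 \int_0^oo w t / (r + t)^4 dt], a smooth function which subadditivity
    makes comparable to [w]. The function [u = sqrt (T <z> + C y^2)] is comparable
    to [|y| + omega <z>], and [u^3 Delta u] equals
    [C (T + beta (r^2 T'' - r T') / 2)] with [0 <= beta <= 1] and [r = <z>], plus a
    term which is at least [- 52 omega 1 ^ 2 T]. The kernel is chosen so that
    [T + (r^2 T'' - r T') / 2] is [5/2] times the integral of the nonnegative
    [r^3 w t (t - r)^2 / (r + t)^6], hence comparable to [T]. For [C] large,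
    [u^3 Delta u >= T] everywhere, and [u^2] is at most a multiple of [T] where
    [|y| <= 2 omega |z|]. Since [u] is smooth, its distributional Laplacian is the
    measure with density [Delta u], and [Delta u >= 0] gives the sub-mean value
    inequality on all circles. *)

(** * Partial derivatives and the classes Ck *)

(** The square root is what yields the bound 1/p: for fixed [x], sqrt (T + C y^2) is a smoothed
    multiple of |y| whose second derivative in [y] has order 1/omega on the strip |y| <= 2 omega.
    The obstacle is the radial variation of T. Since omega is only subadditive, T'' may be negative,
    and T'' enters u^3 Delta u multiplied by C y^2, hence with the same order C T as the good term;
    enlarging C cannot beat it. So T itself has to satisfy T + (r^2 T'' - r T') / 2 >= c T with c >
    0. For a kernel r^(n-1) / (r + t)^n the left-hand side multiplies the kernel by a quadratic
    polynomial in s = r / (r + t), with leading coefficient n (n + 1) / 2 and discriminant 5 n (n -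
    4) / 4. It is nonnegative for n <= 4 and takes negative values on [0, 1] for n > 4. On the other
    hand w may grow quadratically as far as subadditivity tells, so among integers convergence
    requires n >= 4. The exponent 4 is the one that meets both demands, and there the polynomial is
    a perfect square. *)

Lemma is_derive_comp_fun (R : realType) (V : normedModType R) (f : V -> R)
    (g : R -> R) (z v : V) (df dg : R) :
  is_derive z v f df -> is_derive (f z) 1 g dg ->
  is_derive z v (g \o f) (dg * df).
Proof.
(* A derivative along [v] is the derivative at 0 of the restriction to the line through [z], where
   the one-variable chain rule applies. *)
move=> Hf Hg; pose k h := f (h *: v + z).
have k0 : k 0 = f z by rewrite /k scale0r add0r.
have Dk : derivable k 0 1 by apply: (derivable1P f z v).1; case: Hf.
have dk : 'D_1 k 0 = df.
  rewrite -(derive_val (is_derive := Hf)) /derive; congr (lim _).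
  congr ((_ @ 0^')%classic); apply/funext => h /=.
  by rewrite /k addr0 scale0r add0r [h *: 1]mulr1.
have Hk : is_derive (0 : R) (1 : R) k df by apply: DeriveDef.
have Hgk : is_derive (k 0) 1 g dg by rewrite k0.
have [Dgk dgk] := is_derive1_comp Hgk Hk.
apply: DeriveDef; first exact: (derivable1P (g \o f) z v).2.
rewrite -dgk /derive; congr (lim _).
congr ((_ @ 0^')%classic); apply/funext => h /=.
by rewrite /k addr0 scale0r add0r [h *: 1]mulr1.
Qed.

(** The cross terms f' g' cancel. This is the divergence form behind the symmetry of the
    Laplacian. *)
Lemma is_derive_wronskian (R : realType) (V : normedModType R)
    (f f' g g' : V -> R) (z v : V) (f'' g'' : R) :
  is_derive z v f (f' z) -> is_derive z v g (g' z) ->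
  is_derive z v f' f'' -> is_derive z v g' g'' ->
  is_derive z v (fun w => f w * g' w - g w * f' w) (f z * g'' - g z * f'').
Proof.
move=> Df Dg Df' Dg'.
apply: is_derive_eq (is_deriveB (is_deriveM Df Dg') (is_deriveM Dg Df')) _.
have alg (a b c d e h : R) : a * b + c * d - (e * h + d * c) = a * b - e * h by ring.
exact: alg.
Qed.

Lemma is_derive_fst (R : realType) (z v : R * R) : is_derive z v fst v.1.
Proof.
have H : (fun h : R => h^-1 *: ((fst \o shift z) (h *: v) - z.1)) @ 0^' --> v.1.
  apply: cvg_near_cst; near=> h => /=.
  rewrite addrK scalerA mulVf ?scale1r//.
  by near: h; exact: nbhs_dnbhs_neq.
by apply: DeriveDef; [apply/cvg_ex; exists v.1|exact/cvg_lim].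
Unshelve. all: by end_near. Qed.

Lemma is_derive_snd (R : realType) (z v : R * R) : is_derive z v snd v.2.
Proof.
have H : (fun h : R => h^-1 *: ((snd \o shift z) (h *: v) - z.2)) @ 0^' --> v.2.
  apply: cvg_near_cst; near=> h => /=.
  rewrite addrK scalerA mulVf ?scale1r//.
  by near: h; exact: nbhs_dnbhs_neq.
by apply: DeriveDef; [apply/cvg_ex; exists v.2|exact/cvg_lim].
Unshelve. all: by end_near. Qed.

Section Ck_closure.
Context {R : realType}.
Implicit Types (f g : R * R -> R) (k n : nat).

Let e1 : R * R := (1, 0).
Let e2 : R * R := (0, 1).

Lemma Ck_continuous k f : Ck k f -> continuous f.
Proof. by case: k => [|k] []. Qed.

Lemma Ck_is_derive k f : Ck k.+1 f ->
  [/\ forall z, is_derive z e1 f (dx f z), forall z, is_derive z e2 f (dy f z),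
      Ck k (dx f) & Ck k (dy f)].
Proof. by case=> _ [d1 d2 c1 c2]; split=> // z; exact/derivableP. Qed.

Lemma dx_is_derive f fx : (forall z, is_derive z e1 f (fx z)) -> dx f = fx.
Proof. by move=> H; apply/funext => z; rewrite /dx derive_val. Qed.

Lemma dy_is_derive f fy : (forall z, is_derive z e2 f (fy z)) -> dy f = fy.
Proof. by move=> H; apply/funext => z; rewrite /dy derive_val. Qed.

Lemma CkS k f fx fy : continuous f ->
  (forall z, is_derive z e1 f (fx z)) -> (forall z, is_derive z e2 f (fy z)) ->
  Ck k fx -> Ck k fy -> Ck k.+1 f.
Proof.
move=> cf f1 f2 cx cy; split=> //; rewrite (dx_is_derive f1) (dy_is_derive f2).
by split.
Qed.

Lemma Ck_pred k f : Ck k.+1 f -> Ck k f.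
Proof.
elim: k f => [|k IH] f Hf; first by split=> //; exact: Ck_continuous Hf.
have [f1 f2 cx cy] := Ck_is_derive Hf.
exact: CkS (Ck_continuous Hf) f1 f2 (IH _ cx) (IH _ cy).
Qed.

Lemma Ck_cst k (c : R) : Ck k (fun=> c).
Proof.
elim: k c => [|k IH] c; first by split=> // z; exact: cvg_cst.
by apply: (@CkS _ _ (fun=> 0) (fun=> 0)) => // z; exact: cvg_cst.
Qed.

Lemma Ck_fst k : Ck k (fst : R * R -> R).
Proof.
case: k => [|k]; first by split=> // z; exact: cvg_fst.
apply: (@CkS _ _ (fun=> 1) (fun=> 0)) => [z|z|z||].
- exact: cvg_fst.
- exact: is_derive_fst.
- exact: is_derive_fst.
- exact: Ck_cst.
- exact: Ck_cst.
Qed.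

Lemma Ck_snd k : Ck k (snd : R * R -> R).
Proof.
case: k => [|k]; first by split=> // z; exact: cvg_snd.
apply: (@CkS _ _ (fun=> 0) (fun=> 1)) => [z|z|z||].
- exact: cvg_snd.
- exact: is_derive_snd.
- exact: is_derive_snd.
- exact: Ck_cst.
- exact: Ck_cst.
Qed.

Lemma Ck_add k f g : Ck k f -> Ck k g -> Ck k (fun z => f z + g z).
Proof.
elim: k f g => [|k IH] f g Hf Hg.
  by split=> // z; apply: cvgD; [exact: (Hf.1 z)|exact: (Hg.1 z)].
have [f1 f2 fx fy] := Ck_is_derive Hf; have [g1 g2 gx gy] := Ck_is_derive Hg.
apply: CkS (IH _ _ fx gx) (IH _ _ fy gy) => z.
by apply: cvgD; [exact: (Hf.1 z)|exact: (Hg.1 z)].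
Qed.

Lemma Ck_mul k f g : Ck k f -> Ck k g -> Ck k (fun z => f z * g z).
Proof.
elim: k f g => [|k IH] f g Hf Hg.
  by split=> // z; apply: cvgM; [exact: (Hf.1 z)|exact: (Hg.1 z)].
have [f1 f2 fx fy] := Ck_is_derive Hf; have [g1 g2 gx gy] := Ck_is_derive Hg.
have [f0 g0] := (Ck_pred Hf, Ck_pred Hg).
apply: (CkS (fx := fun z => f z * dx g z + g z * dx f z)
            (fy := fun z => f z * dy g z + g z * dy f z)) => [z||].
- by apply: cvgM; [exact: (Hf.1 z)|exact: (Hg.1 z)].
- by apply: Ck_add; apply: IH.
- by apply: Ck_add; apply: IH.
Qed.

Lemma Ck_exp k n f : Ck k f -> Ck k (fun z => f z ^+ n).
Proof.
move=> Hf; elim: n => [|n IH]; first exact: Ck_cst.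
by under [X in Ck _ X]eq_fun do rewrite exprS; exact: Ck_mul.
Qed.

(** A family closed under differentiation up to constants lets the induction on [k] run for all
    indices [n] at once. It serves twice: for real powers, and for the kernel integrals, whose
    derivative raises the exponent by one. *)
Lemma Ck_comp k f (g : nat -> R -> R) (c : nat -> R) n :
  (forall z, 0 < f z) ->
  (forall m (x : R), 0 < x -> is_derive x 1 (g m) (c m * g m.+1 x)) ->
  Ck k f -> Ck k (fun z => g n (f z)).
Proof.
move=> f0 dg; have cg m (x : R) : 0 < x -> {for x, continuous (g m)}.
  by move=> x0; apply/differentiable_continuous/derivable1_diffP; case: (dg m x x0).
elim: k n f f0 => [|k IH] n f f0 Hf.
  by split=> // z; apply: continuous_comp; [exact: (Hf.1 z)|exact: cg].
have [f1 f2 fx fy] := Ck_is_derive Hf; have Hf' := Ck_pred Hf.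
apply: (CkS (fx := fun z => c n * g n.+1 (f z) * dx f z)
            (fy := fun z => c n * g n.+1 (f z) * dy f z)) => [z|z|z||].
- by apply: continuous_comp; [exact: (Hf.1 z)|exact: cg].
- by apply: is_derive_comp_fun; exact: dg.
- by apply: is_derive_comp_fun; exact: dg.
- by do 2?apply: Ck_mul => //; [exact: Ck_cst|exact: IH].
- by do 2?apply: Ck_mul => //; [exact: Ck_cst|exact: IH].
Qed.

Lemma Ck_powR k f (a : R) : (forall z, 0 < f z) -> Ck k f ->
  Ck k (fun z => f z `^ a).
Proof.
move=> f0; pose g (n : nat) x := x `^ (a - n%:R).
rewrite (_ : (fun z => _) = (fun z => g 0 (f z))); last first.
  by apply/funext => z; rewrite /g subr0.
apply: (@Ck_comp _ _ g (fun n => a - n%:R)) => // m x x0.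
by rewrite /g -natr1 opprD addrA; exact: is_derive1_powR.
Qed.

End Ck_closure.

Lemma continuous_comp_pair (R : realType) (T : topologicalType) (f : R * R -> R)
    (a b : T -> R) (t : T) : continuous f ->
  {for t, continuous a} -> {for t, continuous b} ->
  {for t, continuous (fun s => f (a s, b s))}.
Proof.
move=> cf ca cb.
have cab : (a s, b s) @[s --> t] --> (a t, b t) by exact: cvg_pair ca cb.
exact: (cvg_comp _ f cab (cf _)).
Qed.

(** * Measures with a density *)

Section density_measure.
Local Open Scope ereal_scope.
Context d (T : measurableType d) (R : realType).
Variables (m : {measure set T -> \bar R}) (g : T -> R).
Hypotheses (g_ge0 : forall x, (0 <= g x)%R) (mg : measurable_fun setT g).

(** The two proofs are arguments because the measure structure declared on this constant depends on
    them. *)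
Definition density of (forall x, (0 <= g x)%R) & measurable_fun setT g :
    set T -> \bar R :=
  fun A => \int[m]_(x in A) (g x)%:E.

Local Notation mu := (density g_ge0 mg).

Let mu0 : mu set0 = 0.
Proof. exact: integral_set0. Qed.

Let mu_ge0 A : 0 <= mu A.
Proof. by apply: integral_ge0 => x _; rewrite lee_fin. Qed.

Let mu_sigma : semi_sigma_additive mu.
Proof.
apply: semi_sigma_additive_nng_induced; first exact/measurable_EFinP.
by move=> x; rewrite lee_fin.
Qed.

HB.instance Definition _ := isMeasure.Build _ _ _ mu mu0 mu_ge0 mu_sigma.

Import HBNNSimple.

Let integral_density_nnsfun (h : {nnsfun T >-> R}) :
  \int[mu]_x (h x)%:E = \int[m]_x ((h x)%:E * (g x)%:E).
Proof.
have mEg : measurable_fun setT (EFin \o g) by exact/measurable_EFinP.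
have mh r : measurable_fun setT (fun x => (r * \1_(h @^-1` [set r]) x)%:E).
  by apply/measurable_EFinP; exact: measurable_funM.
under [LHS]eq_integral => x _ do rewrite fimfunE -fsumEFin//.
rewrite ge0_integral_fsum//; last by move=> r x _; exact: nnfun_muleindic_ge0.
under [RHS]eq_integral => x _.
  rewrite fimfunE -fsumEFin// ge0_mule_fsuml; last first.
    by move=> r; exact: nnfun_muleindic_ge0.
  over.
rewrite [RHS]ge0_integral_fsum//; last 2 first.
- by move=> r; exact: emeasurable_funM.
- by move=> r x _; rewrite mule_ge0 ?nnfun_muleindic_ge0 ?lee_fin.
apply: eq_fsbigr => r; rewrite inE => -[t _ <-].
under [LHS]eq_integral do rewrite EFinM.
rewrite integralZl_indic_nnsfun//.
under [RHS]eq_integral do rewrite EFinM -muleA.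
rewrite ge0_integralZl//; last 3 first.
- by apply: emeasurable_funM => //; exact/measurable_EFinP.
- by move=> x _; rewrite mule_ge0 ?lee_fin.
- by rewrite lee_fin.
congr (_ * _); rewrite integral_indic// setIT.
rewrite -[LHS]/(\int[m]_(x in _) (g x)%:E) integral_mkcond.
by apply: eq_integral => x _; rewrite epatch_indic muleC.
Qed.

Lemma ge0_integral_density (f : T -> \bar R) :
  (forall x, 0 <= f x) -> measurable_fun setT f ->
  \int[mu]_x f x = \int[m]_x (f x * (g x)%:E).
Proof.
move=> f0 mf; pose h := nnsfun_approx measurableT mf.
have mEg : measurable_fun setT (EFin \o g) by exact/measurable_EFinP.
have mh n : measurable_fun setT (EFin \o h n) by exact/measurable_EFinP.
have hf x : (EFin \o h n) x @[n --> \oo] --> f x by exact: cvg_nnsfun_approx.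
transitivity (limn (fun n => \int[mu]_x (h n x)%:E)).
  rewrite -(@monotone_convergence _ _ _ mu setT measurableT (fun n => EFin \o h n))//.
  - by apply: eq_integral => x _; apply/esym/cvg_lim => //; exact: hf.
  - by move=> n x _; rewrite lee_fin.
  - by move=> x _ a b ab; rewrite lee_fin; exact/lefP/nd_nnsfun_approx.
under eq_fun do rewrite integral_density_nnsfun.
rewrite -(@monotone_convergence _ _ _ m setT measurableT
            (fun n x => (EFin \o h n) x * (g x)%:E))//.
- apply: eq_integral => x _; apply/cvg_lim => //.
  by apply: cvgeZr => //; exact: hf.
- by move=> n; exact: emeasurable_funM.
- by move=> n x _; rewrite mule_ge0 ?lee_fin.
- move=> x _ a b ab; rewrite lee_wpmul2r ?lee_fin//.
  exact/lefP/nd_nnsfun_approx.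
Qed.

(** The integral is the difference of those of the positive and negative parts, and taking these
    parts commutes with multiplication by [g] >= 0. *)
Lemma integral_density (f : T -> R) : measurable_fun setT f ->
  \int[mu]_x (f x)%:E = \int[m]_x (f x * g x)%:E.
Proof.
move=> mf; have mEf : measurable_fun setT (EFin \o f) by exact/measurable_EFinP.
rewrite [LHS]integralE [RHS]integralE; congr (_ - _).
- rewrite ge0_integral_density//; last exact: measurable_funepos.
  apply: eq_integral => x _; rewrite !funeposE -!EFin_max -EFinM.
  by rewrite maxr_pMl// mul0r.
- rewrite ge0_integral_density//; last exact: measurable_funeneg.
  apply: eq_integral => x _; rewrite !funenegE -!EFinN -!EFin_max -EFinM.
  by rewrite maxr_pMl// mul0r mulNr.
Qed.

End density_measure.

(** * The plane *)

Section plane_measurability.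
Context {R : realType}.
Local Notation plane := (measurableTypeR R * measurableTypeR R)%type.

(** The plane carries the product sigma-algebra, so an open set has to be exhibited as a countable
    union of boxes, here those with rational corners; balls of the sup norm are boxes too. *)
Lemma open_measurable_plane (A : set plane) :
  open (A : set (R * R)) -> measurable A.
Proof.
move=> oA.
pose box (q : (rat * rat) * (rat * rat)) : set plane :=
  `]ratr q.1.1, ratr q.1.2[%classic `*` `]ratr q.2.1, ratr q.2.2[%classic.
have -> : A = \bigcup_(q in [set q | box q `<=` A]) box q.
  apply/seteqP; split=> [z Az|z [q /= qA zq]]; last exact: qA.
  have /nbhs_ballP[e /= e0 eA] : nbhs (z : R * R) A.
    by apply: open_nbhs_nbhs; split.
  have lo (t : R) : t - e < t by rewrite ltrBlDr ltrDl.
  have hi (t : R) : t < t + e by rewrite ltrDl.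
  have [a] := rat_in_itvoo (lo z.1); rewrite in_itv/= => /andP[a1 a2].
  have [b] := rat_in_itvoo (hi z.1); rewrite in_itv/= => /andP[b1 b2].
  have [c] := rat_in_itvoo (lo z.2); rewrite in_itv/= => /andP[c1 c2].
  have [d'] := rat_in_itvoo (hi z.2); rewrite in_itv/= => /andP[d1 d2].
  exists ((a, b), (c, d')); last by split; rewrite /= in_itv/=; apply/andP.
  move=> w [/=]; rewrite !in_itv/= => /andP[w1 w2] /andP[w3 w4].
  apply: eA; split; rewrite /ball/= ltr_distlC; apply/andP; split; lra.
rewrite bigcup_mkcond; apply: countable_bigcupT_measurable => // q.
case: ifPn => // _; apply: measurableX; exact: measurable_itv.
Qed.

Lemma continuous_measurable_plane (f : R * R -> R) :
  continuous f -> measurable_fun (setT : set plane) f.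
Proof.
move=> cf; apply: (measurability _ (RGenOpens.measurableE R)).
move=> _ [_ [a [b ->] <-]]; rewrite setTI.
apply: open_measurable_plane; move/continuousP : cf; apply.
exact: interval_open.
Qed.

Lemma compact_measurable_plane (K : set plane) :
  compact (K : set (R * R)) -> measurable K.
Proof.
move=> /compact_closed; move=> /(_ (@norm_hausdorff _ _)) cK.
rewrite -[K]setCK; apply: measurableC; apply: open_measurable_plane.
exact: closed_openC.
Qed.

Lemma compact_norm_le (K : set (R * R)) : compact K ->
  exists2 N : R, 0 < N & forall z, K z -> `|z| <= N.
Proof.
move=> /compact_bounded[M [_ HM]]; exists (`|M| + 1); first by rewrite ltr_wpDl.
by move=> z Kz; apply: HM => //; rewrite (le_lt_trans (ler_norm _))// ltrDl.
Qed.

Lemma norm_le_box (N : R) (z : R * R) : `|z| <= N ->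
  (`[- N, N]%classic `*` `[- N, N]%classic) z.
Proof.
rewrite prod_normE ge_max => /andP[z1 z2].
by split; rewrite /= in_itv/= -ler_norml.
Qed.

Lemma leb2_compact (K : set plane) : compact (K : set (R * R)) ->
  (leb2 R K < +oo)%E.
Proof.
move=> cK; have [N N0 KN] := compact_norm_le cK.
apply: (@le_lt_trans _ _ (leb2 R (`[- N, N]%classic `*` `[- N, N]%classic))).
  apply: le_measure; rewrite ?inE.
  - exact: compact_measurable_plane.
  - by apply: measurableX; exact: measurable_itv.
  - by move=> z /KN; exact: norm_le_box.
pose I : set (measurableTypeR R) := `[- N, N]%classic.
have mI : measurable I by exact: measurable_itv.
rewrite [X in (X < _)%E](_ : _ = lebesgue_measure I * lebesgue_measure I)%E; last first.
  exact: product_measure1E.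
have NN : - N < N by lra.
rewrite !lebesgue_measure_itv/= lte_fin NN -EFinD -EFinM; exact: ltry.
Qed.

Lemma continuous_integrable_plane (K : set plane) (f : R * R -> R) :
  compact (K : set (R * R)) -> continuous f -> (leb2 R).-integrable K (EFin \o f).
Proof.
move=> cK cf; apply: measurable_bounded_integrable.
- exact: compact_measurable_plane.
- exact: leb2_compact.
- apply: measurable_funTS; exact: continuous_measurable_plane.
- have cfK : {within K, continuous f} by exact: continuous_subspaceT.
  have /compact_bounded[M [_ mrt]] := continuous_compact cfK cK.
  by exists M; split; rewrite ?num_real // => ? ? ? ?; exact: mrt.
Qed.

(** The strict inequality describes an open set, so directional derivatives inherit the property
    with the same [N]. *)
Definition vanishes_off (N : R) (f : R * R -> R) := forall z, N < `|z| -> f z = 0.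

Lemma compact_box (N : R) : compact (`[- N, N]%classic `*` `[- N, N]%classic : set (R * R)).
Proof. by apply: compact_setX; exact: segment_compact. Qed.

Lemma vanishes_off_integrable (N : R) (f : R * R -> R) :
  continuous f -> vanishes_off N f -> (leb2 R).-integrable setT (EFin \o f).
Proof.
move=> cf fN; pose K : set plane := `[- N, N]%classic `*` `[- N, N]%classic.
have cK : compact (K : set (R * R)) by exact: compact_box.
have -> : EFin \o f = (EFin \o f) \_ K.
  apply/funext => z; rewrite patchE; case: ifPn => // /negP zK /=.
  rewrite fN// ltNge; apply/negP => zN; apply: zK; apply/mem_set.
  exact: norm_le_box.
have mK : measurable K by exact: compact_measurable_plane.
apply: (integrable_mkcond (mu := leb2 R) (EFin \o f) mK).1.
exact: continuous_integrable_plane.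
Qed.

Lemma open_norm_gt (N : R) : open [set z : R * R | N < `|z|].
Proof.
rewrite (_ : [set z | _] = (fun z : R * R => `|z|) @^-1` [set x | N < x])//.
apply: open_comp; last exact: open_gt.
by move=> z _; exact: norm_continuous.
Qed.

Lemma vanishes_off_derive (N : R) (f : R * R -> R) (v : R * R) :
  vanishes_off N f -> vanishes_off N (fun z => 'D_v f z).
Proof.
move=> fN z zN; rewrite (@near_eq_derive _ _ _ f (cst 0)).
  by rewrite derive_cst.
have : nbhs z [set z : R * R | N < `|z|].
  by apply: open_nbhs_nbhs; split; [exact: open_norm_gt|].
by apply: filterS => w /fN.
Qed.

End plane_measurability.

(** * Distributional Laplacian *)

Section integration_by_parts_plane.
Context {R : realType}.
Implicit Types (F f u phi : R * R -> R).

Lemma is_derive_slice1 F (x y d : R) :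
  is_derive ((x, y) : R * R) ((1, 0) : R * R) F d ->
  is_derive x 1 (fun t => F (t, y)) d.
Proof.
have E : (fun h : R => h^-1 *: ((F \o shift (x, y)) (h *: (1, 0)) - F (x, y))) =
    (fun h => h^-1 *: (((fun t => F (t, y)) \o shift x) (h *: 1) - F (x, y))).
  apply/funext => h /=; congr (_ *: (F _ - _)).
  by congr pair; rewrite /= scaler0 add0r.
by case=> dF <-; apply: DeriveDef; rewrite /derivable /derive -/(shift _) -E.
Qed.

Lemma is_derive_slice2 F (x y d : R) :
  is_derive ((x, y) : R * R) ((0, 1) : R * R) F d ->
  is_derive y 1 (fun t => F (x, t)) d.
Proof.
have E : (fun h : R => h^-1 *: ((F \o shift (x, y)) (h *: (0, 1)) - F (x, y))) =
    (fun h => h^-1 *: (((fun t => F (x, t)) \o shift y) (h *: 1) - F (x, y))).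
  apply/funext => h /=; congr (_ *: (F _ - _)).
  by congr pair; rewrite /= scaler0 add0r.
by case=> dF <-; apply: DeriveDef; rewrite /derivable /derive -/(shift _) -E.
Qed.

Lemma integral_derive_eq0 (N : R) (g dg : R -> R) :
  (forall x : R, is_derive x 1 g (dg x)) -> continuous dg ->
  (forall x, N < `|x| -> g x = 0) ->
  (\int[lebesgue_measure]_x (dg x)%:E = 0)%E.
Proof.
(* [N] may be negative, and the endpoints of integration must lie strictly beyond it, where [g] is
   known to vanish. *)
move=> Dg cdg gN; pose M := `|N| + 1.
have M0 : 0 < M by rewrite ltr_wpDl.
have NM : N < M by rewrite (le_lt_trans (ler_norm _))// ltrDl.
have dgM x : M < `|x| -> dg x = 0.
  move=> xM; rewrite -(derive_val (is_derive := Dg x)) (@near_eq_derive _ _ _ g (cst 0)).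
    by rewrite derive_cst.
  have : nbhs x [set t : R | N < `|t|].
    apply: open_nbhs_nbhs; split; last exact: lt_trans xM.
    rewrite (_ : [set t | _] = (fun t : R => `|t|) @^-1` [set s | N < s])//.
    by apply: open_comp => [t _|]; [exact: norm_continuous|exact: open_gt].
  by apply: filterS => t /gN.
rewrite (_ : (fun x => (dg x)%:E) = (EFin \o dg) \_ `[- M, M]); last first.
  apply/funext => x; rewrite patchE; case: ifPn => // /negP xM /=.
  rewrite dgM// ltNge; apply/negP => Mx; apply: xM; apply/mem_set.
  by rewrite /= in_itv/= -ler_norml.
rewrite -integral_mkcond.
have cg : continuous g.
  move=> x; apply/differentiable_continuous/derivable1_diffP.
  by case: (Dg x).
rewrite (@continuous_FTC2 _ dg g (- M) M).
- by rewrite !gN ?normrN ?gtr0_norm// -EFinB subr0.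
- by rewrite gtrN.
- exact: continuous_subspaceT.
- split.
  + by move=> x _; case: (Dg x).
  + by apply: cvg_at_right_filter; exact: cg.
  + by apply: cvg_at_left_filter; exact: cg.
- by move=> x _; rewrite derive1E derive_val.
Qed.

Lemma integral_dx_eq0 (N : R) F Fx :
  (forall z, is_derive z ((1, 0) : R * R) F (Fx z)) -> continuous Fx ->
  vanishes_off N F -> (\int[leb2 R]_z (Fx z)%:E = 0)%E.
Proof.
move=> DF cFx FN.
have FxN : vanishes_off N Fx.
  move=> z zN; rewrite -(derive_val (is_derive := DF z)).
  exact: vanishes_off_derive zN.
rewrite /leb2 -integral21_prod_meas1; last exact: vanishes_off_integrable FxN.
apply: integral0_eq => y _; apply: (@integral_derive_eq0 N (fun x => F (x, y))).
- by move=> x; exact: is_derive_slice1.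
- by move=> x; apply: continuous_comp_pair => //; exact: cvg_cst.
- move=> x xN; apply: FN.
  by rewrite prod_normE lt_max/= xN.
Qed.

Lemma integral_dy_eq0 (N : R) F Fy :
  (forall z, is_derive z ((0, 1) : R * R) F (Fy z)) -> continuous Fy ->
  vanishes_off N F -> (\int[leb2 R]_z (Fy z)%:E = 0)%E.
Proof.
move=> DF cFy FN.
have FyN : vanishes_off N Fy.
  move=> z zN; rewrite -(derive_val (is_derive := DF z)).
  exact: vanishes_off_derive zN.
rewrite /leb2 -integral12_prod_meas1; last exact: vanishes_off_integrable FyN.
apply: integral0_eq => x _; apply: (@integral_derive_eq0 N (fun y => F (x, y))).
- by move=> y; exact: is_derive_slice2.
- by move=> y; apply: continuous_comp_pair => //; exact: cvg_cst.
- move=> y yN; apply: FN.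
  by rewrite prod_normE lt_max/= yN orbT.
Qed.

Lemma Ck_lapl k f : Ck k.+2 f -> Ck k (lapl f).
Proof.
move=> /Ck_is_derive[_ _ /Ck_is_derive[_ _ fxx _] /Ck_is_derive[_ _ _ fyy]].
exact: Ck_add.
Qed.

Lemma integral_add_null (d : measure_display) (T : measurableType d)
    (m : {measure set T -> \bar R}) (a b c s : T -> R) :
  m.-integrable setT (EFin \o a) -> m.-integrable setT (EFin \o b) ->
  m.-integrable setT (EFin \o c) ->
  (\int[m]_z (b z)%:E = 0)%E -> (\int[m]_z (c z)%:E = 0)%E ->
  (forall z, s z = a z + b z + c z) ->
  (\int[m]_z (a z)%:E = \int[m]_z (s z)%:E)%E.
Proof.
move=> ia ib ic b0 c0 sE.
transitivity (\int[m]_z ((a z)%:E + (b z)%:E + (c z)%:E))%E.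
  rewrite integralD//; last exact: integrableD.
  by rewrite integralD// b0 c0 !adde0.
by apply: eq_integral => z _; rewrite sE.
Qed.

(** Green's identity: u Delta phi - phi Delta u is the sum of an x-derivative and a y-derivative of
    compactly supported functions, and both integrate to zero. *)
Lemma lapl_symmetric (N : R) u phi : Ck 2 u -> Ck 2 phi -> vanishes_off N phi ->
  (\int[leb2 R]_z (phi z * lapl u z)%:E = \int[leb2 R]_z (u z * lapl phi z)%:E)%E.
Proof.
move=> cu cp pN.
have [u1 u2 ux uy] := Ck_is_derive cu; have [p1 p2 px py] := Ck_is_derive cp.
have [ux1 _ uxx _] := Ck_is_derive ux; have [px1 _ pxx _] := Ck_is_derive px.
have [_ uy2 _ uyy] := Ck_is_derive uy; have [_ py2 _ pyy] := Ck_is_derive py.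
have cu0 : Ck 0 u by exact/Ck_pred/Ck_pred.
have cp0 : Ck 0 phi by exact/Ck_pred/Ck_pred.
have pxN := vanishes_off_derive (1, 0) pN.
have pyN := vanishes_off_derive (0, 1) pN.
have lpN : vanishes_off N (lapl phi).
  move=> z zN; rewrite /lapl /dx /dy.
  by rewrite (vanishes_off_derive _ pxN)// (vanishes_off_derive _ pyN)// addr0.
pose Gx z := u z * dx (dx phi) z - phi z * dx (dx u) z.
pose Gy z := u z * dy (dy phi) z - phi z * dy (dy u) z.
have cB (f g a b : R * R -> R) : Ck 0 f -> Ck 0 g -> Ck 0 a -> Ck 0 b ->
    continuous (fun z => f z * g z - a z * b z).
  move=> cf cg ca cb z; apply: cvgB; apply: cvgM.
  - exact: (cf.1 z).
  - exact: (cg.1 z).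
  - exact: (ca.1 z).
  - exact: (cb.1 z).
have cGx : continuous Gx by exact: cB.
have cGy : continuous Gy by exact: cB.
have GxN : vanishes_off N Gx.
  by move=> z zN; rewrite /Gx pN// /dx (vanishes_off_derive _ pxN)// mulr0 mul0r subr0.
have GyN : vanishes_off N Gy.
  by move=> z zN; rewrite /Gy pN// /dy (vanishes_off_derive _ pyN)// mulr0 mul0r subr0.
have IGx : (\int[leb2 R]_z (Gx z)%:E = 0)%E.
  apply: (@integral_dx_eq0 N (fun z => u z * dx phi z - phi z * dx u z) Gx).
  - by move=> z; exact: is_derive_wronskian (u1 z) (p1 z) (ux1 z) (px1 z).
  - exact: cGx.
  - by move=> z zN; rewrite pN// /dx pxN// mulr0 mul0r subr0.
have IGy : (\int[leb2 R]_z (Gy z)%:E = 0)%E.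
  apply: (@integral_dy_eq0 N (fun z => u z * dy phi z - phi z * dy u z) Gy).
  - by move=> z; exact: is_derive_wronskian (u2 z) (p2 z) (uy2 z) (py2 z).
  - exact: cGy.
  - by move=> z zN; rewrite pN// /dy pyN// mulr0 mul0r subr0.
have clu := Ck_lapl cu.
have ipu : (leb2 R).-integrable setT (EFin \o (fun z => phi z * lapl u z)).
  apply: (@vanishes_off_integrable _ N); last by move=> z zN; rewrite pN// mul0r.
  exact: (Ck_continuous (Ck_mul cp0 clu)).
have iGx : (leb2 R).-integrable setT (EFin \o Gx) by exact: vanishes_off_integrable cGx GxN.
have iGy : (leb2 R).-integrable setT (EFin \o Gy) by exact: vanishes_off_integrable cGy GyN.
apply: (integral_add_null ipu iGx iGy IGx IGy) => z.
rewrite /Gx /Gy /lapl; move: (u z) (phi z) (dx _ z) (dy _ z) (dx _ z) (dy _ z) => *.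
by ring.
Qed.

Lemma test_function_vanishes phi : test_function phi ->
  exists N, vanishes_off N phi.
Proof.
move=> [_ /compact_norm_le[N N0 KN]]; exists N => z zN.
apply/eqP; apply: contraTT zN => pz; rewrite -leNgt; apply: KN.
exact: subset_closure.
Qed.

Lemma distr_laplacian_C2 u (cu : Ck 2 u) (lu0 : forall z, 0 <= lapl u z)
    (mlu : measurable_fun setT (lapl u : measurableTypeR R * measurableTypeR R -> R)) :
  distr_laplacian (EFin \o u) (density (leb2 R) lu0 mlu).
Proof.
have clu := Ck_continuous (Ck_lapl cu).
split=> [K cK|K cK|phi tphi].
- have /integrableP[_] := continuous_integrable_plane cK clu.
  apply: le_lt_trans; apply: ge0_le_integral => //.
  + exact: compact_measurable_plane.
  + by move=> z _; rewrite lee_fin.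
  + by apply/measurable_EFinP; exact: measurable_funTS.
  + by apply/measurableT_comp => //; apply/measurable_EFinP; exact: measurable_funTS.
  + by move=> z _; rewrite lee_fin ler_norm.
- exact: continuous_integrable_plane (Ck_continuous cu).
- have [N pN] := test_function_vanishes tphi; case: tphi => cp _.
  rewrite integral_density; last exact: continuous_measurable_plane (Ck_continuous (cp 0)).
  have cp2 : Ck 2 phi := cp 2.
  apply: (etrans (lapl_symmetric cu cp2 pN)).
  by apply: eq_integral => z _; rewrite EFinM.
Qed.

End integration_by_parts_plane.

(** * Circle means *)

Section chain_rule_plane.
Context {R : realType}.
Implicit Types (f : R * R -> R) (a b : R -> R).

Lemma is_derive_continuous (g : R -> R) (x dg : R) :
  is_derive x 1 g dg -> {for x, continuous g}.
Proof. by case=> Dg _; apply/differentiable_continuous/derivable1_diffP. Qed.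

Lemma MVT_unordered (g dg : R -> R) (x y : R) :
  (forall t : R, is_derive t 1 g (dg t)) ->
  exists2 c, `|c - x| <= `|y - x| & g y - g x = dg c * (y - x).
Proof.
move=> Dg; have cg : continuous g by move=> t; exact: is_derive_continuous (Dg t).
have [xy|/ltW yx] := leP x y.
- have [c] := @MVT_segment _ g dg x y xy (fun t _ => Dg t) (continuous_subspaceT cg).
  rewrite in_itv/= => /andP[xc cy] E; exists c => //.
  by rewrite !ger0_norm ?subr_ge0// lerD2r.
- have [c] := @MVT_segment _ g dg y x yx (fun t _ => Dg t) (continuous_subspaceT cg).
  rewrite in_itv/= => /andP[yc cx] E; exists c => //.
    by rewrite !ler0_norm ?subr_le0// lerN2 lerD2r.
  by rewrite -opprB E -mulrN opprB.
Qed.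

(** The increment is split into a horizontal one at the moved height [b (s + t)] and a vertical one
    at the fixed abscissa [a t]. The vertical one falls under the one-variable chain rule. For the
    horizontal one the mean value theorem produces a point tending to [a t], and continuity of
    [dx f] gives the limit. *)
Lemma is_derive_curve f a b (t da db : R) : Ck 1 f ->
  is_derive t 1 a da -> is_derive t 1 b db ->
  is_derive t 1 (fun s => f (a s, b s))
    (dx f (a t, b t) * da + dy f (a t, b t) * db).
Proof.
move=> cf Da Db; have [f1 f2 /Ck_continuous cfx _] := Ck_is_derive cf.
have mvt s := MVT_unordered (a t) (a (s + t)) (fun x => is_derive_slice1 (f1 (x, b (s + t)))).
(* The intermediate points are chosen as a function of [s], so that their limit can be taken. *)
pose xi s := xget 0 [set c | `|c - a t| <= `|a (s + t) - a t| /\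
  f (a (s + t), b (s + t)) - f (a t, b (s + t)) =
    dx f (c, b (s + t)) * (a (s + t) - a t)].
have xiP s : `|xi s - a t| <= `|a (s + t) - a t| /\
  f (a (s + t), b (s + t)) - f (a t, b (s + t)) =
    dx f (xi s, b (s + t)) * (a (s + t) - a t).
  by have [c c1 c2] := mvt s; rewrite /xi; case: xgetP => [y _ []//|/(_ c)]; case.
have Db' : is_derive t 1 (fun s => f (a t, b s)) (dy f (a t, b t) * db).
  exact: (@is_derive_comp_fun _ _ b (fun y => f (a t, y)) t 1 db _ Db
          (is_derive_slice2 (f2 (a t, b t)))).
have shift0 : (s + t @[s --> (0 : R)^'] --> t).
  have H : s + t @[s --> (0 : R)] --> 0 + t by apply: cvgD; [exact: cvg_id|exact: cvg_cst].
  by rewrite add0r in H; exact: cvg_within_filter H.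
have ca0 : (a (s + t) @[s --> 0^'] --> a t).
  exact: (cvg_comp (fun s => s + t) a shift0 (is_derive_continuous Da)).
have cb0 : (b (s + t) @[s --> 0^'] --> b t).
  exact: (cvg_comp (fun s => s + t) b shift0 (is_derive_continuous Db)).
have cxi : xi s @[s --> 0^'] --> a t.
  apply/cvgrPdist_le => e e0; move/cvgrPdist_le : ca0 => /(_ e e0).
  apply: filterS => s; rewrite distrC => H; rewrite distrC.
  exact: le_trans (xiP s).1 H.
have cfxi : dx f (xi s, b (s + t)) @[s --> 0^'] --> dx f (a t, b t).
  have cp : (xi s, b (s + t)) @[s --> 0^'] --> (a t, b t) by exact: cvg_pair cxi cb0.
  exact: (cvg_comp _ (dx f) cp (cfx _)).
have qa : s^-1 * (a (s + t) - a t) @[s --> 0^'] --> da.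
  case: Da => + <-; rewrite /derivable /derive => /cvg_ex[l Hl].
  rewrite (cvg_lim _ Hl)//; apply: cvg_trans Hl; apply: near_eq_cvg.
  by near=> s; rewrite /= [s *: 1]mulr1.
have qb : s^-1 * (f (a t, b (s + t)) - f (a t, b t)) @[s --> 0^'] -->
    dy f (a t, b t) * db.
  case: Db' => + <-; rewrite /derivable /derive => /cvg_ex[l Hl].
  rewrite (cvg_lim _ Hl)//; apply: cvg_trans Hl; apply: near_eq_cvg.
  by near=> s; rewrite /= [s *: 1]mulr1.
have H : (fun h : R => h^-1 *: (((fun s => f (a s, b s)) \o shift t) (h *: 1)
    - f (a t, b t))) @ 0^' --> dx f (a t, b t) * da + dy f (a t, b t) * db.
  have H : dx f (xi s, b (s + t)) * (s^-1 * (a (s + t) - a t)) +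
      s^-1 * (f (a t, b (s + t)) - f (a t, b t)) @[s --> 0^'] -->
      dx f (a t, b t) * da + dy f (a t, b t) * db.
    exact: (cvgD (cvgM cfxi qa) qb).
  apply: cvg_trans H; apply: near_eq_cvg.
  near=> s; rewrite /= [s *: 1]mulr1 mulrCA -(xiP s).2 -mulrDr.
  by rewrite [_ *: _]/(_ * _) addrA subrK.
by apply: DeriveDef; [apply/cvg_ex; exists (dx f (a t, b t) * da + dy f (a t, b t) * db)
                     |exact/cvg_lim].
Unshelve. all: by end_near. Qed.

End chain_rule_plane.

(** * Differentiation of integrals over a segment with respect to a parameter *)

Section sub_mean_value.
Context {R : realType}.
Local Notation leb := (@lebesgue_measure R).

Lemma is_derive_Rintegral (F dF : R -> R -> R) (a b r : R) :
  (forall s, continuous (F s)) -> continuous (fun z : R * R => dF z.1 z.2) ->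
  (forall s t : R, is_derive s 1 (F ^~ t) (dF s t)) ->
  is_derive r 1 (fun s => \int[leb]_(t in `[a, b]) F s t)
    (\int[leb]_(t in `[a, b]) dF r t).
Proof.
move=> cF cdF DF; have dFE s t : derive1 (F ^~ t) s = dF s t.
  by rewrite derive1E derive_val.
have cK : compact (`[r - 1, r + 1]%classic `*` `[a, b]%classic : set (R * R)).
  by apply: compact_setX; exact: segment_compact.
have /compact_bounded[M [_ HM]] := continuous_compact (continuous_subspaceT cdF) cK.
pose G := `|M| + 1.
have GP s t : s \in `]r - 1, r + 1[ -> t \in `[a, b] -> `|dF s t| <= G.
  move=> sr tab; apply: HM; first by rewrite (le_lt_trans (ler_norm _))// ltrDl.
  by exists (s, t) => //; split => //; exact: subset_itv_oo_cc.
have cI (g : R -> R) : continuous g -> leb.-integrable `[a, b] (EFin \o g).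
  move=> cg; apply: continuous_compact_integrable; first exact: segment_compact.
  exact: continuous_subspaceT.
have rI : `]r - 1, r + 1[%classic r by rewrite /= in_itv/=; apply/andP; split; lra.
have HG s t : `]r - 1, r + 1[%classic s -> `[a, b]%classic t -> `|partial1of2 F s t| <= G.
  by move=> sI tI; rewrite /partial1of2 dFE; exact: GP.
have H := @cvg_differentiation_under_integral R _ _ leb F `[a, b]%classic
  (measurable_itv _) r (r - 1) (r + 1) rI (fun s _ => cI _ (cF s))
  (fun s t _ _ => @ex_derive _ _ _ _ _ _ _ (DF s t)) (fun=> G)
  (fun=> addr_ge0 (normr_ge0 M) ler01) (cI _ (@cst_continuous _ _ G)).
have {}H := H (fun s t sI tI => HG s t sI tI).
have E : \int[leb]_(t in `[a, b]) partial1of2 F r t = \int[leb]_(t in `[a, b]) dF r t.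
  by apply: eq_Rintegral => t _; exact: dFE.
rewrite E in H.
have {}H : (fun h : R => h^-1 *: (((fun s => \int[leb]_(t in `[a, b]) F s t) \o shift r)
   (h *: 1) - \int[leb]_(t in `[a, b]) F r t)) @ 0^' --> \int[leb]_(t in `[a, b]) dF r t.
  apply: cvg_trans H.
  by apply: near_eq_cvg; near=> s; rewrite /= [s *: 1]mulr1.
by apply: DeriveDef; [apply/cvg_ex; exists (\int[leb]_(t in `[a, b]) dF r t)
                     |exact/cvg_lim].
Unshelve. all: by end_near. Qed.



End sub_mean_value.

(** * Monotonicity of circle means when the Laplacian is nonnegative *)

Section circle_means.
Context {R : realType}.
Local Notation leb := (@lebesgue_measure R).
Variables (u : R * R -> R) (z : R * R).
Hypotheses (cu : Ck 2 u) (lu0 : forall w, 0 <= lapl u w).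

Let pt (r t : R) : R * R := (z.1 + r * cos t, z.2 + r * sin t).
(** [A] and [dA] are the first and second radial derivatives of [u]. [W] is the angular derivative
    divided by the radius, written so that it also makes sense at radius 0. *)
Let A r t := dx u (pt r t) * cos t + dy u (pt r t) * sin t.
Let dA r t :=
  (dx (dx u) (pt r t) * cos t + dy (dx u) (pt r t) * sin t) * cos t +
  (dx (dy u) (pt r t) * cos t + dy (dy u) (pt r t) * sin t) * sin t.
Let W r t := dy u (pt r t) * cos t - dx u (pt r t) * sin t.

Let cux : Ck 1 (dx u). Proof. by have [] := Ck_is_derive cu. Qed.
Let cuy : Ck 1 (dy u). Proof. by have [] := Ck_is_derive cu. Qed.

Let continuous_cos2 : continuous (fun w : R * R => cos w.2).
Proof. by move=> w; apply: continuous_comp; [exact: cvg_snd|exact: continuous_cos]. Qed.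

Let continuous_sin2 : continuous (fun w : R * R => sin w.2).
Proof. by move=> w; apply: continuous_comp; [exact: cvg_snd|exact: continuous_sin]. Qed.

Let continuous_pt (g : R * R -> R) : continuous g -> continuous (fun w : R * R => g (pt w.1 w.2)).
Proof.
move=> cg w; apply: continuous_comp_pair => //.
- apply: cvgD; first exact: cvg_cst.
  by apply: cvgM; [exact: cvg_fst|exact: continuous_cos2].
- apply: cvgD; first exact: cvg_cst.
  by apply: cvgM; [exact: cvg_fst|exact: continuous_sin2].
Qed.

Let continuous_rot (g h : R * R -> R) : continuous g -> continuous h ->
  continuous (fun w : R * R => g w * cos w.2 + h w * sin w.2).
Proof.
move=> cg ch w; apply: cvgD; apply: cvgM.
- exact: cg.
- exact: continuous_cos2.
- exact: ch.
- exact: continuous_sin2.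
Qed.

Let continuous_A : continuous (fun w : R * R => A w.1 w.2).
Proof.
apply: continuous_rot; apply: continuous_pt.
- exact: Ck_continuous cux.
- exact: Ck_continuous cuy.
Qed.

Let cuxx : continuous (dx (dx u)).
Proof. by have [_ _ + _] := Ck_is_derive cux; exact: Ck_continuous. Qed.
Let cuxy : continuous (dy (dx u)).
Proof. by have [_ _ _] := Ck_is_derive cux; exact: Ck_continuous. Qed.
Let cuyx : continuous (dx (dy u)).
Proof. by have [_ _ + _] := Ck_is_derive cuy; exact: Ck_continuous. Qed.
Let cuyy : continuous (dy (dy u)).
Proof. by have [_ _ _] := Ck_is_derive cuy; exact: Ck_continuous. Qed.

Let continuous_dA : continuous (fun w : R * R => dA w.1 w.2).
Proof. by do 2!apply: continuous_rot; apply: continuous_pt. Qed.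

Let continuous_slice (g : R -> R -> R) r :
  continuous (fun w : R * R => g w.1 w.2) -> continuous (g r).
Proof.
move=> cg t; apply: (@continuous_comp_pair _ _ (fun w => g w.1 w.2) (fun=> r) id) => //.
exact: cvg_cst.
Qed.

Let continuous_slice_int (g : R -> R -> R) r :
  continuous (fun w : R * R => g w.1 w.2) ->
  leb.-integrable `[0, 2 * pi] (EFin \o g r).
Proof.
move=> cg; apply: continuous_compact_integrable; first exact: segment_compact.
by apply: continuous_subspaceT; exact: continuous_slice.
Qed.

Let is_derive_radial (g : R * R -> R) (r t : R) : Ck 1 g ->
  is_derive r 1 (fun s => g (pt s t))
    (dx g (pt r t) * cos t + dy g (pt r t) * sin t).
Proof.
move=> cg; have D (p q : R) : is_derive r 1 (fun s => p + s * q) q.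
  apply: is_derive_eq (is_deriveD (is_derive_cst p r 1)
    (is_deriveM (is_derive_id r 1) (is_derive_cst q r 1))) _.
  by rewrite /GRing.scale/= mulr0 mulr1 !add0r.
exact: is_derive_curve.
Qed.

Let is_derive_angular (g : R * R -> R) (r t : R) : Ck 1 g ->
  is_derive t 1 (fun s => g (pt r s))
    (dx g (pt r t) * (- (r * sin t)) + dy g (pt r t) * (r * cos t)).
Proof.
move=> cg; apply: is_derive_curve => //.
- apply: is_derive_eq (is_deriveD (is_derive_cst z.1 t 1)
    (is_deriveM (is_derive_cst r t 1) (is_derive_cos t))) _.
  by rewrite /GRing.scale/= mulr0 addr0 add0r mulrN.
- apply: is_derive_eq (is_deriveD (is_derive_cst z.2 t 1)
    (is_deriveM (is_derive_cst r t 1) (is_derive_sin t))) _.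
  by rewrite /GRing.scale/= mulr0 addr0 add0r.
Qed.

Let is_derive_A (r t : R) : is_derive r 1 (A ^~ t) (dA r t).
Proof.
have H1 := is_derive_radial r t cux; have H2 := is_derive_radial r t cuy.
apply: is_derive_eq (is_deriveD (is_deriveM H1 (is_derive_cst (cos t) r 1))
  (is_deriveM H2 (is_derive_cst (sin t) r 1))) _.
have alg (p q c s d e : R) : p * 0 + c * d + (q * 0 + s * e) = d * c + e * s by ring.
exact: alg.
Qed.

(** The Laplacian in polar coordinates: r Delta u is the radial part A + r dA plus the angular
    derivative of [W]. *)
Let dW r t := r * lapl u (pt r t) - (A r t + r * dA r t).

Let is_derive_W (r t : R) : is_derive t 1 (W r) (dW r t).
Proof.
have H1 := is_derive_angular r t cux; have H2 := is_derive_angular r t cuy.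
apply: is_derive_eq (is_deriveB (is_deriveM H2 (is_derive_cos t))
  (is_deriveM H1 (is_derive_sin t))) _.
have alg (r' ux uy uxx uxy uyx uyy c s : R) : c ^+ 2 + s ^+ 2 = 1 ->
    uy * (- s) + c * (uyx * (- (r' * s)) + uyy * (r' * c)) -
      (ux * c + s * (uxx * (- (r' * s)) + uxy * (r' * c))) =
    r' * (uxx + uyy) - ((ux * c + uy * s) +
      r' * ((uxx * c + uxy * s) * c + (uyx * c + uyy * s) * s)).
  by move=> cs; rewrite -[r' * (uxx + uyy)]mulr1 -cs; ring.
exact: alg (cos2Dsin2 t).
Qed.

Let continuous_dW : continuous (fun w : R * R => dW w.1 w.2).
Proof.
have clu : continuous (lapl u) := Ck_continuous (Ck_lapl cu).
move=> w; apply: cvgB.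
  by apply: cvgM; [exact: cvg_fst|exact: (continuous_pt clu)].
apply: cvgD; first exact: continuous_A.
by apply: cvgM; [exact: cvg_fst|exact: continuous_dA].
Qed.

Let integral_dW_eq0 r : \int[leb]_(t in `[0, 2 * pi]) dW r t = 0.
Proof.
have pi2 : (0 : R) < 2 * pi by rewrite mulr_gt0// pi_gt0.
have cW : continuous (W r) by move=> t; exact: is_derive_continuous (is_derive_W r t).
rewrite /Rintegral (@continuous_FTC2 _ (dW r) (W r) 0 (2 * pi) pi2) /=.
- rewrite /W /pt mulr_natl cos2pi sin2pi cos0 sin0.
  by rewrite subrr.
- by apply: continuous_subspaceT; exact: continuous_slice continuous_dW.
- split.
  + by move=> t _; case: (is_derive_W r t).
  + by apply: cvg_at_right_filter; exact: cW.
  + by apply: cvg_at_left_filter; exact: cW.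
- by move=> t _; rewrite derive1E; exact: (derive_val (is_derive := is_derive_W r t)).
Qed.

Let mean (r : R) := \int[leb]_(t in `[0, 2 * pi]) u (pt r t).
Let dmean (r : R) := \int[leb]_(t in `[0, 2 * pi]) A r t.
Let ddmean (r : R) := \int[leb]_(t in `[0, 2 * pi]) dA r t.

Let is_derive_mean (r : R) : is_derive r 1 mean (dmean r).
Proof.
apply: (is_derive_Rintegral (F := fun r t => u (pt r t))) => [s||s t].
- exact: (continuous_slice (g := fun r t => u (pt r t)) (continuous_pt (Ck_continuous cu))).
- exact: continuous_A.
- exact: is_derive_radial (Ck_pred cu).
Qed.

Let is_derive_dmean (r : R) : is_derive r 1 dmean (ddmean r).
Proof.
apply: is_derive_Rintegral => [s||s t].
- exact: continuous_slice continuous_A.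
- exact: continuous_dA.
- exact: is_derive_A.
Qed.

(** The integral of [dW] over a period is zero; adding it turns the integrand into [r * lapl u]. *)
Let ddmean_ge0 r : 0 <= r -> 0 <= dmean r + r * ddmean r.
Proof.
move=> r0; have iA := continuous_slice_int r continuous_A.
have idA := continuous_slice_int r continuous_dA.
have idW := continuous_slice_int r continuous_dW.
have irdA : leb.-integrable `[0, 2 * pi] (EFin \o (fun t => r * dA r t)).
  exact: (@integrableZl _ _ _ leb _ (measurable_itv _) r _ idA).
rewrite /dmean /ddmean -RintegralZl// -RintegralD//.
have iD : leb.-integrable `[0, 2 * pi] (EFin \o (fun t => A r t + r * dA r t)).
  exact: (@integrableD _ _ _ leb _ (measurable_itv _) _ _ iA irdA).
rewrite -[leRHS]add0r -[X in _ <= X + _](integral_dW_eq0 r) -RintegralD//.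
by apply: Rintegral_ge0 => t _; rewrite /dW subrK mulr_ge0.
Qed.

(** With m the integral over the circle of radius r, (r m')' >= 0 and r m' vanishes at 0, so r m' >=
    0. Hence m is nondecreasing, and its value at 0 is 2 pi u(z). *)
Lemma circle_mean_ge r : 0 <= r ->
  2 * pi * u z <= \int[leb]_(t in `[0, 2 * pi]) u (pt r t).
Proof.
move=> r0; pose P s := s * dmean s.
have DP (s : R) : is_derive s 1 P (dmean s + s * ddmean s).
  apply: is_derive_eq (is_deriveM (is_derive_id s 1) (is_derive_dmean s)) _.
  have alg (a b c : R) : a * b + c * 1 = c + a * b by ring.
  exact: alg.
have cP : continuous P by move=> s; exact: is_derive_continuous (DP s).
have cm : continuous mean by move=> s; exact: is_derive_continuous (is_derive_mean s).
have P0 s : 0 <= s -> 0 <= P s.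
  move=> s0; have -> : 0 = P 0 by rewrite /P mul0r.
  apply: (@ger0_derive1_ndecry _ P 0) => //.
  - move=> t; rewrite in_itv/= andbT => t0; rewrite derive1E.
    by rewrite (derive_val (is_derive := DP t)) ddmean_ge0// ltW.
  - exact: continuous_subspaceT.
have -> : 2 * pi * u z = mean 0.
  rewrite /mean /pt; under eq_Rintegral do rewrite !mul0r !addr0.
  rewrite -surjective_pairing Rintegral_cst//= lebesgue_measure_itv/=.
  have pi2 : (0 : R) < 2 * pi by rewrite mulr_gt0// pi_gt0.
  by rewrite lte_fin pi2 -EFinB subr0 mulrC.
apply: (@ger0_derive1_ndecry _ mean 0) => //.
- by move=> t _; case: (is_derive_mean t).
- move=> t; rewrite in_itv/= andbT => t0; rewrite derive1E.
  rewrite (derive_val (is_derive := is_derive_mean t)).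
  by rewrite -(pmulr_rge0 _ t0) P0// ltW.
- exact: continuous_subspaceT.
Qed.

End circle_means.

Lemma subharmonic_C2 (R : realType) (u : R * R -> R) :
  Ck 2 u -> (forall z, 0 <= lapl u z) -> subharmonic (EFin \o u).
Proof.
move=> cu lu0; have cu0 := Ck_continuous cu; split.
- by move=> z; rewrite ltry.
- by exists 0.
- move=> z a /=; rewrite lte_fin => az.
  exists [set w | a < - u w]; last by move=> w aw /=; rewrite lte_fin.
  have cN : continuous (fun w => - u w) by move=> w; apply: cvgN; exact: cu0.
  by apply: (cN z [set x | a < x]); apply: open_nbhs_nbhs; split; [exact: open_gt|].
- move=> z r r0.
  have pi2 : (0 : R) < 2 * pi by rewrite mulr_gt0// pi_gt0.
  have H := circle_mean_ge z cu lu0 (ltW r0).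
  have cF : continuous (fun t : R => u (z.1 + r * cos t, z.2 + r * sin t)).
    move=> t; apply: continuous_comp_pair => //; apply: cvgD; try exact: cvg_cst.
    + by apply: cvgM; [exact: cvg_cst|exact: continuous_cos].
    + by apply: cvgM; [exact: cvg_cst|exact: continuous_sin].
  have iF : (@lebesgue_measure R).-integrable `[0, 2 * pi]
      (EFin \o (fun t : R => u (z.1 + r * cos t, z.2 + r * sin t))).
    apply: continuous_compact_integrable; first exact: segment_compact.
    exact: continuous_subspaceT.
  rewrite -[X in (_ <= _ * X)%E]fineK; last exact: integrable_fin_num iF.
  by rewrite -EFinM lee_fin mulrC ler_pdivlMr// mulrC.
Qed.

(** * Power kernels *)

Section power_kernel.
Context {R : realType}.
Local Notation leb := (@lebesgue_measure R).
Variable w : R -> R.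
Hypotheses (mw : measurable_fun (`[0, +oo[%classic : set R) w)
  (w_ge0 : forall t, 0 <= t -> 0 <= w t)
  (w_incr : forall s t, 0 <= s -> s <= t -> w s <= w t)
  (w_growth : forall s t, 0 < s -> 0 <= t -> w t <= (1 + t / s) ^+ 2 * w s).

Definition kernel_fun (n : nat) (r t : R) : R := w t * (r + t)^-1 ^+ n.

Definition kernel_int (n : nat) (r : R) : R :=
  \int[leb]_(t in `[0, +oo[) kernel_fun n r t.

Local Notation k := kernel_fun.
Local Notation I := kernel_int.

Lemma kernel_fun_ge0 n r t : 0 < r -> 0 <= t -> 0 <= k n r t.
Proof.
move=> r0 t0; rewrite mulr_ge0 ?w_ge0// exprn_ge0// invr_ge0.
by rewrite addr_ge0// ltW.
Qed.

Lemma kernel_funS n r t : 0 < r -> 0 <= t -> r * k n.+1 r t <= k n r t.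
Proof.
move=> r0 t0; have rt : 0 < r + t by rewrite ltr_wpDr.
rewrite /kernel_fun exprS mulrCA ler_wpM2l ?w_ge0// mulrA -[leRHS]mul1r.
rewrite ler_wpM2r ?exprn_ge0 ?invr_ge0 ?(ltW rt)// ler_pdivrMr// mul1r.
by rewrite lerDl.
Qed.

Lemma measurable_inv_add (r : R) : 0 < r ->
  measurable_fun (`[0, +oo[%classic : set R) (fun t : R => (r + t)^-1).
Proof.
move=> r0; apply: subspace_continuous_measurable_fun; first exact: measurable_itv.
apply/subspace_continuousP => t /=; rewrite in_itv/= andbT => t0.
apply: cvg_within_filter; apply: cvgV; first by rewrite gt_eqF// ltr_wpDr.
by apply: cvgD; [exact: cvg_cst|exact: cvg_id].
Qed.

Lemma measurable_kernel_fun n r : 0 < r -> measurable_fun (`[0, +oo[%classic : set R) (k n r).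
Proof.
move=> r0; apply: measurable_funM => //.
by apply: measurable_funX; exact: measurable_inv_add.
Qed.

Lemma integral_inv_sqr (r : R) : 0 < r ->
  (\int[leb]_(t in `[0%R, +oo[) ((r + t)^-1 ^+ 2)%:E = (r^-1)%:E)%E.
Proof.
move=> r0; have rt (t : R) : 0 <= t -> r + t != 0.
  by move=> t0; rewrite gt_eqF// ltr_wpDr.
have cV (t : R) : 0 <= t -> {for t, continuous (fun s => (r + s)^-1)}.
  move=> t0; apply: cvgV; first exact: rt.
  by apply: cvgD; [exact: cvg_cst|exact: cvg_id].
have DV (t : R) : 0 <= t -> is_derive t 1 (fun s => - (r + s)^-1) ((r + t)^-1 ^+ 2).
  move=> t0; have D1 : is_derive t 1 (fun s : R => r + s) 1.
    by apply: is_derive_eq (is_deriveD (is_derive_cst r t 1) (is_derive_id t 1)) _; rewrite add0r.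
  have DI : is_derive t 1 (fun s => (r + s)^-1) (- (r + t) ^- 2 *: 1).
    apply: DeriveDef; first by apply: derivableV; [exact: rt|case: D1].
    by rewrite deriveV ?rt// (derive_val (is_derive := D1)).
  apply: is_derive_eq (is_deriveN DI) _.
  by rewrite [_ *: 1]mulr1 opprK exprVn.
rewrite (@ge0_continuous_FTC2y _ _ (fun s => - (r + s)^-1) 0 0).
- by rewrite addr0 sub0e -EFinN opprK.
- by move=> t _; rewrite exprn_even_ge0.
- apply/subspace_continuousP => t /=; rewrite in_itv/= andbT => t0.
  apply: cvg_within_filter.
  exact: (cvgM (cV t t0) (cV t t0)).
- rewrite -oppr0; apply: cvgN.
  apply/cvgrPdist_lt => e e0; near=> t; rewrite sub0r normrN.
  have t0 : 0 < t by near: t; exact: nbhs_pinfty_gt.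
  have et : e^-1 < t by near: t; apply: nbhs_pinfty_gt; rewrite num_real.
  rewrite ger0_norm ?invr_ge0 ?addr_ge0 1?ltW//.
  rewrite invf_plt ?posrE ?addr_gt0//; lra.
- by move=> t /ltW t0; case: (DV t t0).
- apply: cvg_at_right_filter; apply: cvgN; exact: cV.
- move=> t; rewrite in_itv/= andbT => /ltW t0; rewrite derive1E.
  exact: (derive_val (is_derive := DV t t0)).
Unshelve. all: by end_near. Qed.

Lemma integrable_inv_sqr (r : R) : 0 < r ->
  leb.-integrable `[0, +oo[ (EFin \o (fun t : R => (r + t)^-1 ^+ 2)).
Proof.
move=> r0; apply/integrableP; split.
  by apply/measurable_EFinP; apply: measurable_funX; exact: measurable_inv_add.
under eq_integral.
  move=> t _; rewrite /= ger0_norm ?exprn_even_ge0//; over.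
by rewrite integral_inv_sqr// ltry.
Qed.

(** The growth hypothesis says w t <= w r ((r + t) / r)^2, which costs exactly two powers of (r +
    t)^-1. From exponent 4 on, an integrable factor (r + t)^-2 is left. *)
Lemma kernel_fun_le n r t : 0 < r -> 0 <= t ->
  k n.+2 r t <= w r / r ^+ 2 * (r + t)^-1 ^+ n.
Proof.
move=> r0 t0; have rt : 0 < r + t by rewrite ltr_wpDr.
rewrite /kernel_fun -addn2 exprD [_ ^+ n * _]mulrC mulrA.
rewrite ler_wpM2r ?exprn_ge0 ?invr_ge0 ?(ltW rt)//.
apply: (@le_trans _ _ ((1 + t / r) ^+ 2 * w r * (r + t)^-1 ^+ 2)).
  by rewrite ler_wpM2r ?w_growth// exprn_ge0// invr_ge0 ltW.
rewrite le_eqVlt; apply/orP; left; apply/eqP.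
by field; rewrite !gt_eqF.
Qed.

Lemma integrable_kernel_fun n r : 0 < r ->
  leb.-integrable `[0, +oo[ (EFin \o k n.+4 r).
Proof.
move=> r0; have r2 := integrable_inv_sqr r0.
apply: (@le_integrable _ _ _ leb _ (measurable_itv _) _
  (EFin \o (fun t => (w r / r ^+ 2 * r^-1 ^+ n) * (r + t)^-1 ^+ 2))).
- by apply/measurable_EFinP; exact: measurable_kernel_fun.
- move=> t /=; rewrite in_itv/= andbT => t0; have rt : 0 < r + t by rewrite ltr_wpDr.
  rewrite lee_fin ger0_norm ?kernel_fun_ge0//.
  apply: le_trans (ler_norm _); apply: le_trans (kernel_fun_le n.+2 r0 t0) _.
  rewrite -[leRHS]mulrA ler_wpM2l ?divr_ge0 ?w_ge0 ?exprn_ge0 ?(ltW r0)//.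
  rewrite -addn2 exprD ler_wpM2r ?exprn_ge0 ?invr_ge0 ?(ltW rt)//.
  by rewrite lerXn2r ?nnegrE ?invr_ge0 ?(ltW r0) ?(ltW rt)// lef_pV2 ?posrE// lerDl.
- exact: (@integrableZl _ _ _ leb _ (measurable_itv _) _ _ r2).
Qed.

Lemma is_derive_kernel_fun n (r t : R) : 0 < r -> 0 <= t ->
  is_derive r 1 (fun s => k n s t) (- n%:R * k n.+1 r t).
Proof.
move=> r0 t0; have rt : r + t != 0 by rewrite gt_eqF// ltr_wpDr.
have D1 : is_derive r 1 (fun s : R => s + t) 1.
  by apply: is_derive_eq (is_deriveD (is_derive_id r 1) (is_derive_cst t r 1)) _; rewrite addr0.
have DI : is_derive r 1 (fun s => (s + t)^-1) (- (r + t) ^- 2 *: 1).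
  apply: DeriveDef; first by apply: derivableV => //; case: D1.
  by rewrite deriveV// (derive_val (is_derive := D1)).
have DX : is_derive r 1 (fun s => (s + t)^-1 ^+ n) (- n%:R * (r + t)^-1 ^+ n.+1).
  case: n => [|n]; first by rewrite oppr0 mul0r; exact: is_derive_cst.
  have := is_deriveX n.+1 DI.
  rewrite (_ : (fun s => (s + t)^-1) ^+ n.+1 = (fun s => (s + t)^-1 ^+ n.+1)); last first.
    by apply/funext => s; rewrite exprfctE.
  move=> H; apply: is_derive_eq H _.
  have alg (a b : R) : (a * b ^+ n) * (- b ^+ 2 * 1) = - a * b ^+ n.+2.
    by rewrite !exprS; ring.
  by rewrite -exprVn; exact: alg.
apply: is_derive_eq (is_deriveM (is_derive_cst (w t) r 1) DX) _.
have alg (a b c d : R) : a * (b * c) + d * 0 = b * (a * c) by ring.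
exact: alg.
Qed.

Lemma kernel_fun_antitone n (r s t : R) : 0 < r -> r <= s -> 0 <= t ->
  k n s t <= k n r t.
Proof.
move=> r0 rs t0; have rt : 0 < r + t by rewrite ltr_wpDr.
have st : 0 < s + t by rewrite (lt_le_trans rt)// lerD2r.
rewrite /kernel_fun ler_wpM2l ?w_ge0// lerXn2r ?nnegrE ?invr_ge0 ?(ltW rt) ?(ltW st)//.
by rewrite lef_pV2 ?posrE// lerD2r.
Qed.

Lemma is_derive_kernel_int n (r : R) : 0 < r ->
  is_derive r 1 (I n.+4) (- n.+4%:R * I n.+4.+1 r).
Proof.
move=> r0; set N := n.+4; have r2 : 0 < r / 2 by lra.
have rI : `]r / 2, r + 1[%classic r by rewrite /= in_itv/=; apply/andP; split; lra.
have pos s : `]r / 2, r + 1[%classic s -> r / 2 < s.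
  by rewrite /= in_itv/= => /andP[+ _].
have pos0 s : `]r / 2, r + 1[%classic s -> 0 < s by move=> /pos; exact: lt_trans.
(* The kernel decreases in its first variable and the neighbourhood of [r] stays above r / 2, so the
   value at r / 2 dominates there. *)
pose G t := `|N%:R * k N.+1 (r / 2) t|.
have iG : leb.-integrable `[0, +oo[ (EFin \o G).
  have H := @integrableZl _ _ _ leb _ (measurable_itv _) N%:R _
    (integrable_kernel_fun n.+1 r2).
  exact: (integrable_norm H).
have ge0 (t : R) : `[0%R, +oo[%classic t -> 0 <= t by rewrite /= in_itv/= andbT.
have dE (s t : R) : `]r / 2, r + 1[%classic s -> `[0%R, +oo[%classic t ->
    partial1of2 (k N) s t = - N%:R * k N.+1 s t.
  move=> sI /ge0 t0; rewrite partial1of2E.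
  exact: (derive_val (is_derive := is_derive_kernel_fun N (pos0 s sI) t0)).
have HG (s t : R) : `]r / 2, r + 1[%classic s -> `[0%R, +oo[%classic t ->
    `|partial1of2 (k N) s t| <= G t.
  move=> sI tI; rewrite (dE s t sI tI) mulNr normrN /G.
  have t0 := ge0 t tI; have s0 := pos0 s sI.
  have k1 := kernel_fun_ge0 N.+1 s0 t0; have k2 := kernel_fun_ge0 N.+1 r2 t0.
  rewrite (ger0_norm (mulr_ge0 (ler0n _ _) k1)) (ger0_norm (mulr_ge0 (ler0n _ _) k2)).
  by rewrite ler_wpM2l ?ler0n// kernel_fun_antitone//; exact/ltW/pos.
have H := @cvg_differentiation_under_integral R _ _ leb (k N) `[0%R, +oo[%classic
  (measurable_itv _) r (r / 2) (r + 1) rI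
  (fun s sI => integrable_kernel_fun n (pos0 s sI))
  (fun s t sI tI => @ex_derive _ _ _ _ _ _ _
     (is_derive_kernel_fun N (pos0 s sI) (ge0 t tI)))
  G (fun=> normr_ge0 _) iG (fun s t sI tI => HG s t sI tI).
have E : \int[leb]_(t in `[0%R, +oo[) partial1of2 (k N) r t = - N%:R * I N.+1 r.
  rewrite /kernel_int -RintegralZl//; last exact: (integrable_kernel_fun n.+1 r0).
  by apply: eq_Rintegral => t; rewrite inE => tI; exact: dE.
rewrite E in H.
have {}H : (fun h : R => h^-1 *: ((I N \o shift r) (h *: 1) - I N r)) @ 0^' -->
    - N%:R * I N.+1 r.
  apply: cvg_trans H.
  by apply: near_eq_cvg; near=> s; rewrite /= [s *: 1]mulr1.
by apply: DeriveDef; [apply/cvg_ex; exists (- N%:R * I N.+1 r)|exact/cvg_lim].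
Unshelve. all: by end_near. Qed.

Lemma kernel_int_ge0 n (r : R) : 0 < r -> 0 <= I n r.
Proof.
move=> r0; apply: Rintegral_ge0 => t; rewrite /= in_itv/= andbT => t0.
exact: kernel_fun_ge0.
Qed.

Lemma kernel_intS n (r : R) : 0 < r -> r * I n.+4.+1 r <= I n.+4 r.
Proof.
move=> r0; have i5 := integrable_kernel_fun n.+1 r0.
rewrite /kernel_int -RintegralZl//; apply: le_Rintegral => //.
- exact: (@integrableZl _ _ _ leb _ (measurable_itv _) r _ i5).
- exact: integrable_kernel_fun.
- by move=> t; rewrite /= in_itv/= andbT => t0; exact: kernel_funS.
Qed.

(** After the growth bound the integrand is w r / r^2 times (r + t)^-2, whose integral is 1 / r, so
    the constant is exactly 1. *)
Lemma kernel_int4_le (r : R) : 0 < r -> r ^+ 3 * I 4 r <= w r.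
Proof.
move=> r0; have r2 := integrable_inv_sqr r0.
have H : I 4 r <= w r / r ^+ 2 * r^-1.
  have E : \int[leb]_(t in `[0%R, +oo[) (r + t)^-1 ^+ 2 = r^-1.
    by rewrite /Rintegral (integral_inv_sqr r0).
  rewrite -[X in _ * X]E -RintegralZl//; apply: le_Rintegral => //.
  - exact: (integrable_kernel_fun 0 r0).
  - exact: (@integrableZl _ _ _ leb _ (measurable_itv _) _ _ r2).
  - by move=> t; rewrite /= in_itv/= andbT => t0; exact: kernel_fun_le.
apply: (le_trans (ler_wpM2l (exprn_ge0 3 (ltW r0)) H)).
rewrite le_eqVlt; apply/orP; left; apply/eqP.
by field; rewrite gt_eqF.
Qed.

(* The integrand of the right-hand side is [w t (t - r)^2 / (r + t)^6]. *)
Lemma kernel_int_combination (r : R) : 0 < r ->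
  w r / 4096 <= r ^+ 3 * (I 4 r - 4 * r * I 5 r + 4 * r ^+ 2 * I 6 r).
Proof.
move=> r0.
have i4 := integrable_kernel_fun 0 r0; have i5 := integrable_kernel_fun 1 r0.
have i6 := integrable_kernel_fun 2 r0.
have z5 := @integrableZl _ _ _ leb _ (measurable_itv _) (4 * r) _ i5.
have z6 := @integrableZl _ _ _ leb _ (measurable_itv _) (4 * r ^+ 2) _ i6.
pose f t := k 4 r t - 4 * r * k 5 r t + 4 * r ^+ 2 * k 6 r t.
have iB : leb.-integrable `[0%R, +oo[ (EFin \o (fun t => k 4 r t - 4 * r * k 5 r t)).
  exact: (@integrableB _ _ _ leb _ (measurable_itv _) _ _ i4 z5).
have iF : leb.-integrable `[0%R, +oo[ (EFin \o f).
  exact: (@integrableD _ _ _ leb _ (measurable_itv _) _ _ iB z6).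
have E : I 4 r - 4 * r * I 5 r + 4 * r ^+ 2 * I 6 r = \int[leb]_(t in `[0%R, +oo[) f t.
  by rewrite /kernel_int -!RintegralZl// -RintegralB// -RintegralD.
have fE t : 0 <= t -> f t = w t * ((t - r) ^+ 2 * (r + t)^-1 ^+ 6).
  move=> t0; have rt : r + t != 0 by rewrite gt_eqF// ltr_wpDr.
  by rewrite /f /kernel_fun; field.
have f0 t : 0 <= t -> 0 <= f t.
  move=> t0; rewrite fE// mulr_ge0 ?w_ge0//.
  by rewrite mulr_ge0// exprn_even_ge0.
pose c := w r * (r ^+ 2 * (4 * r)^-1 ^+ 6).
have r4 : 0 <= (4 * r)^-1 by rewrite invr_ge0 mulr_ge0// ltW.
have c0 : 0 <= c by rewrite !mulr_ge0 ?exprn_ge0 ?w_ge0 ?(ltW r0).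
(* The square vanishes at t = r, so the bound is taken away from that point. On [2r, 3r] one has w t
   >= w r, t - r >= r and r + t <= 4r; the last gives 4096 = 4^6. *)
have cf t : 2 * r <= t -> t <= 3 * r -> c <= f t.
  move=> t2 t3; have t0 : 0 <= t by lra.
  have p1 : w r <= w t by apply: w_incr; lra.
  have p2 : r ^+ 2 <= (t - r) ^+ 2 by rewrite lerXn2r ?nnegrE; lra.
  have p3 : (4 * r)^-1 <= (r + t)^-1 by rewrite lef_pV2 ?posrE; lra.
  have p4 : (4 * r)^-1 ^+ 6 <= (r + t)^-1 ^+ 6.
    by rewrite lerXn2r// nnegrE; exact: le_trans p3.
  rewrite fE// /c; apply: ler_pM p1 _.
  - exact/w_ge0/ltW.
  - by rewrite mulr_ge0 ?exprn_ge0 ?(ltW r0).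
  - by apply: ler_pM p2 p4; rewrite exprn_ge0// ltW.
have H : c * r <= \int[leb]_(t in `[0%R, +oo[) f t.
  rewrite -lee_fin /Rintegral fineK; last exact: integrable_fin_num iF.
  have mf : measurable_fun (`[0%R, +oo[%classic : set R) (EFin \o f).
    exact: measurable_int iF.
  have sub : (`[2 * r, 3 * r]%classic : set R) `<=` `[0%R, +oo[.
    by move=> t; rewrite /= !in_itv/= andbT => /andP[t1 _]; lra.
  have A : (\int[leb]_(t in `[(2 * r)%R, (3 * r)%R]) (f t)%:E <=
            \int[leb]_(t in `[0%R, +oo[) (f t)%:E)%E.
    apply: ge0_subset_integral => // t; rewrite /= in_itv/= andbT => t0.
    by rewrite lee_fin f0.
  have B : (\int[leb]_(t in `[(2 * r)%R, (3 * r)%R]) (cst c%:E) t <=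
            \int[leb]_(t in `[(2 * r)%R, (3 * r)%R]) (f t)%:E)%E.
    apply: (@ge0_le_integral _ _ _ leb _ (measurable_itv _) (cst c%:E) (EFin \o f)).
    - by move=> t _; rewrite lee_fin.
    - exact: measurable_cst.
    - exact: measurable_funS mf.
    - by move=> t; rewrite /= in_itv/= => /andP[t1 t2]; rewrite lee_fin cf.
  refine (le_trans (le_trans _ B) A).
  rewrite integral_cst//= lebesgue_measure_itv/= lte_fin ifT; last by lra.
  by rewrite -EFinB -EFinM lee_fin ler_wpM2l//; lra.
rewrite E; apply: le_trans (ler_wpM2l (exprn_ge0 3 (ltW r0)) H).
rewrite le_eqVlt; apply/orP; left; apply/eqP; rewrite /c.
by field; rewrite gt_eqF.
Qed.

End power_kernel.

(** * The potential *)

Lemma is_derive_inv_fun (R : realType) (V : normedModType R) (f : V -> R)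
    (z v : V) (df : R) : f z != 0 -> is_derive z v f df ->
  is_derive z v (fun x => (f x)^-1) (- df / f z ^+ 2).
Proof.
move=> f0 Df; apply: DeriveDef; first by apply: derivableV => //; case: Df.
by rewrite deriveV// (derive_val (is_derive := Df)) [_ *: _]mulNr mulrC mulNr.
Qed.

Lemma is_derive_sqrt_fun (R : realType) (V : normedModType R) (f : V -> R)
    (z v : V) (df : R) : 0 < f z -> is_derive z v f df ->
  is_derive z v (fun x => Num.sqrt (f x)) (df / (2 * Num.sqrt (f z))).
Proof.
move=> f0 Df; rewrite [_ / _]mulrC.
exact: is_derive_comp_fun Df (is_derive1_sqrt f0).
Qed.

(** The second derivative of sqrt f. The common denominator is the reason for studying u^3 Delta u:
    it is polynomial in f and its derivatives. *)
Lemma is_derive_sqrt_fun2 (R : realType) (V : normedModType R) (f g : V -> R)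
    (z v : V) (dg : R) : (forall x, 0 < f x) ->
  (forall x, is_derive x v f (g x)) -> is_derive z v g dg ->
  is_derive z v (fun x => g x / (2 * Num.sqrt (f x)))
    ((dg * f z / 2 - g z ^+ 2 / 4) / Num.sqrt (f z) ^+ 3).
Proof.
move=> f0 Df Dg; have s0 : Num.sqrt (f z) != 0 by rewrite gt_eqF// sqrtr_gt0.
have D1 := is_deriveM (is_derive_cst (2 : R) z v) (is_derive_sqrt_fun (f0 z) (Df z)).
have D2 : is_derive z v (fun x => 2 * Num.sqrt (f x)) (g z / Num.sqrt (f z)).
  apply: is_derive_eq D1 _.
  have alg (a b c : R) : c != 0 -> 2 * (a / (2 * c)) + b * 0 = a / c.
    by move=> c0; field.
  exact: alg.
have n0 : 2 * Num.sqrt (f z) != 0 by rewrite mulf_neq0// pnatr_eq0.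
have D3 := is_deriveM Dg (is_derive_inv_fun (f := fun x => 2 * Num.sqrt (f x)) n0 D2).
apply: is_derive_eq D3 _.
have alg (a b c s : R) : s != 0 -> s ^+ 2 = c ->
    a * (- (a / s) / (2 * s) ^+ 2) + (2 * s)^-1 * b =
    (b * c / 2 - a ^+ 2 / 4) / s ^+ 3.
  by move=> c0 <-; field.
by apply: alg => //; rewrite sqr_sqrtr// ltW.
Qed.

(** * Derivatives of a radial profile plus a multiple of y^2 *)

Section radial_composition.
Context {R : realType}.

(** The Japanese bracket: unlike |z| it is smooth at the origin, and it keeps the radial variable in
    [1, +oo[. *)
Definition jbr (z : R * R) : R := Num.sqrt (1 + z.1 ^+ 2 + z.2 ^+ 2).

Lemma jbr_arg_ge1 (z : R * R) : 1 <= 1 + z.1 ^+ 2 + z.2 ^+ 2.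
Proof. by rewrite -addrA lerDl addr_ge0// sqr_ge0. Qed.

Lemma jbr_ge1 (z : R * R) : 1 <= jbr z.
Proof. by rewrite -[leLHS]sqrtr1 ler_wsqrtr// jbr_arg_ge1. Qed.

Lemma jbr_gt0 (z : R * R) : 0 < jbr z.
Proof. exact: lt_le_trans (jbr_ge1 z). Qed.

Lemma sqr_jbr (z : R * R) : jbr z ^+ 2 = 1 + z.1 ^+ 2 + z.2 ^+ 2.
Proof. by rewrite sqr_sqrtr// (le_trans ler01)// jbr_arg_ge1. Qed.

Lemma Ck_sqrt k (f : R * R -> R) : (forall z, 0 < f z) -> Ck k f ->
  Ck k (fun z => Num.sqrt (f z)).
Proof.
move=> f0 cf; rewrite (_ : (fun z => _) = (fun z => f z `^ 2^-1)).
  exact: Ck_powR.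
by apply/funext => z; rewrite powR12_sqrt// ltW.
Qed.

Lemma Ck_jbr k : Ck k jbr.
Proof.
apply: Ck_sqrt => [z|]; first exact: lt_le_trans (jbr_arg_ge1 z).
apply: Ck_add; first apply: Ck_add; first exact: Ck_cst.
- by apply: Ck_exp; exact: Ck_fst.
- by apply: Ck_exp; exact: Ck_snd.
Qed.

Variable v : R * R.

Let dot (z : R * R) := z.1 * v.1 + z.2 * v.2.

Lemma is_derive_jbr (z : R * R) : is_derive z v jbr (dot z / jbr z).
Proof.
have p0 : 0 < 1 + z.1 ^+ 2 + z.2 ^+ 2 by exact: lt_le_trans (jbr_arg_ge1 z).
have D1 := is_deriveX 2 (is_derive_fst z v).
have D2 := is_deriveX 2 (is_derive_snd z v).
have D3 := is_deriveD (is_deriveD (is_derive_cst (1 : R) z v) D1) D2.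
have D : is_derive z v (fun x : R * R => 1 + x.1 ^+ 2 + x.2 ^+ 2) (2 * dot z).
  apply: is_derive_eq D3 _.
  have alg (a b c d : R) : 0 + 2 * a ^+ 1 * b + 2 * c ^+ 1 * d = 2 * (a * b + c * d).
    by ring.
  exact: alg.
have DS : is_derive z v jbr _ := is_derive_sqrt_fun
  (f := fun x : R * R => 1 + x.1 ^+ 2 + x.2 ^+ 2) p0 D.
apply: is_derive_eq DS _.
by rewrite /jbr -mulf_div divff ?mul1r// pnatr_eq0.
Qed.

Lemma is_derive_dot (z : R * R) : is_derive z v dot (v.1 ^+ 2 + v.2 ^+ 2).
Proof.
have D1 := is_deriveM (is_derive_fst z v) (is_derive_cst v.1 z v).
have D2 := is_deriveM (is_derive_snd z v) (is_derive_cst v.2 z v).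
apply: is_derive_eq (is_deriveD D1 D2) _.
have alg (a b c d : R) : a * 0 + c * c + (b * 0 + d * d) = c ^+ 2 + d ^+ 2 by ring.
exact: alg.
Qed.

Variables (T T1 T2 : R -> R) (C : R).
Hypotheses (DT : forall r : R, 0 < r -> is_derive r 1 T (T1 r))
  (DT1 : forall r : R, 0 < r -> is_derive r 1 T1 (T2 r)).

Definition radG (z : R * R) := T (jbr z) + C * z.2 ^+ 2.

(** First derivative of [radG] along [v], and next the second one; a general [v] covers both
    coordinate directions. *)
Definition radGv (z : R * R) := T1 (jbr z) * (dot z / jbr z) + 2 * C * z.2 * v.2.

Definition radGvv (z : R * R) :=
  T2 (jbr z) * (dot z / jbr z) ^+ 2 +
  T1 (jbr z) * ((v.1 ^+ 2 + v.2 ^+ 2) / jbr z - dot z ^+ 2 / jbr z ^+ 3) +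
  2 * C * v.2 ^+ 2.

Lemma is_derive_radG (z : R * R) : is_derive z v radG (radGv z).
Proof.
have D1 := is_derive_comp_fun (is_derive_jbr z) (DT (jbr_gt0 z)).
have D2 := is_deriveM (is_derive_cst C z v) (is_deriveX 2 (is_derive_snd z v)).
apply: is_derive_eq (is_deriveD D1 D2) _.
have alg (a b c d : R) : a + (b * (2 * c ^+ 1 * d) + c ^+ 2 * 0) = a + 2 * b * c * d.
  by ring.
exact: alg.
Qed.

Lemma is_derive_radGv (z : R * R) : is_derive z v radGv (radGvv z).
Proof.
have r0 : jbr z != 0 by rewrite gt_eqF// jbr_gt0.
have D1 := is_derive_comp_fun (is_derive_jbr z) (DT1 (jbr_gt0 z)).
have D2 := is_deriveM (is_derive_dot z) (is_derive_inv_fun r0 (is_derive_jbr z)).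
have D3 := is_deriveM (is_deriveM (is_derive_cst (2 * C) z v) (is_derive_snd z v))
  (is_derive_cst v.2 z v).
apply: is_derive_eq (is_deriveD (is_deriveM D1 D2) D3) _.
have alg (t1 t2 d r n c y e : R) : r != 0 ->
    t1 * (d * (- (d / r) / r ^+ 2) + r^-1 * n) + (d / r) * (t2 * (d / r)) +
      (c * y * 0 + e * (c * e + y * 0)) =
    t2 * (d / r) ^+ 2 + t1 * (n / r - d ^+ 2 / r ^+ 3) + c * e ^+ 2.
  by move=> r0'; field.
exact: alg.
Qed.

End radial_composition.

(** * The algebraic inequality behind the lower bound of the Laplacian *)

Section laplacian_bound.
Context {R : realFieldType}.
Implicit Types a b c d p q rho beta W K C M x y : R.

Let main_term a s beta M : 1 <= M -> 0 <= a -> a <= M * s -> 0 <= beta -> beta <= 1 ->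
  a <= M * ((1 - beta) * a + beta * s).
Proof.
move=> M1 a0 Ms b0 b1.
have s1 : (1 - beta) * a <= (1 - beta) * (M * a).
  by apply: ler_wpM2l; [lra|rewrite ler_peMl].
have s2 : beta * a <= beta * (M * s) by apply: ler_wpM2l.
lra.
Qed.

(** The term with [q] loses at most 9 a^2, the one linear in [p] at most a^2, and p^2 <= 9 a^2 loses
    at most 9 a^2 / 4; the total is rounded up to 13 a^2. *)
Let error_term a p q rho : 0 <= a -> - a <= p -> p <= 3 * a -> - (18 * a) <= q ->
  0 <= rho -> rho <= 1 ->
  - (13 * a) * a <= a * (rho * q / 2 + p * (1 - rho / 2)) - rho * p ^+ 2 / 4.
Proof.
move=> a0 p1 p3 q18 rho0 rho1.
have aa := mulr_ge0 a0 a0.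
have pp : p ^+ 2 <= 9 * (a * a).
  have s1 : 0 <= (p + a) * (3 * a - p) by apply: mulr_ge0; lra.
  have s2 : a * p <= a * (3 * a) by apply: ler_wpM2l.
  by move: s1 s2 aa; rewrite expr2; clear; lra.
have s1 : 0 <= rho * (q + 18 * a) by apply: mulr_ge0; lra.
have s2 : 0 <= (1 - rho / 2) * (p + a) by apply: mulr_ge0; lra.
have s3 : rho * a <= 1 * a by apply: ler_wpM2r.
have s4 : a * - (10 * a) <= a * (rho * q / 2 + p * (1 - rho / 2)).
  apply: ler_wpM2l => //; have s0 := mulr_ge0 rho0 a0.
  by move: s0 s1 s2 s3; clear; lra.
have s5 : rho * p ^+ 2 <= 1 * (9 * (a * a)).
  by apply: ler_pM => //; exact: sqr_ge0.
by move: s4 s5 aa; clear; lra.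
Qed.

(** The terms in C^2 y^2 cancel: one comes from the product of 2 C with C y^2 / 2, the other from
    the square of the y-derivative. What remains is affine in [C]. *)
Let laplacian_identity r x y a T1 T2 C : r != 0 ->
  (T2 * (x / r) ^+ 2 + T1 * (1 / r - x ^+ 2 / r ^+ 3)) * (a + C * y ^+ 2) / 2
    - (T1 * (x / r)) ^+ 2 / 4 +
  ((T2 * (y / r) ^+ 2 + T1 * (1 / r - y ^+ 2 / r ^+ 3) + 2 * C) *
     (a + C * y ^+ 2) / 2 - (T1 * (y / r) + 2 * C * y) ^+ 2 / 4) =
  let rho := (x ^+ 2 + y ^+ 2) / r ^+ 2 in
  let beta := y ^+ 2 / r ^+ 2 * rho in
  let p := r * T1 in let q := r ^+ 2 * T2 in
  C * ((1 - beta) * a + beta * (a + (q - p) / 2)) +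
  (a * (rho * q / 2 + p * (1 - rho / 2)) - rho * p ^+ 2 / 4) / r ^+ 2.
Proof. by move=> r0 /=; field. Qed.

(** Here [a], [b], [c] stand for r^3 I_4, r^4 I_5, r^5 I_6. The part linear in [C] is [C] times a
    convex combination of two numbers that are at least a / M, hence at least (13 K + 1) a. The
    remainder is at least -13 a (a / r^2), hence at least -13 K a, and the difference is [a]. *)
Lemma laplacian_lower_bound r x y a b c T1 T2 W K C M :
  1 <= r -> r ^+ 2 = 1 + x ^+ 2 + y ^+ 2 ->
  0 <= c -> c <= b -> b <= a ->
  r * T1 = 3 * a - 4 * b -> r ^+ 2 * T2 = 6 * a - 24 * b + 20 * c ->
  1 <= M -> a <= W -> W <= M * (a - 4 * b + 4 * c) -> W <= K * r ^+ 2 ->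
  C = M * (13 * K + 1) ->
  a <= (T2 * (x / r) ^+ 2 + T1 * (1 / r - x ^+ 2 / r ^+ 3)) * (a + C * y ^+ 2) / 2
         - (T1 * (x / r)) ^+ 2 / 4 +
       ((T2 * (y / r) ^+ 2 + T1 * (1 / r - y ^+ 2 / r ^+ 3) + 2 * C) *
          (a + C * y ^+ 2) / 2 - (T1 * (y / r) + 2 * C * y) ^+ 2 / 4).
Proof.
move=> r1 rxy c0 cb ba pE qE M1 aW WM WK CE.
have r0 : 0 < r by exact: lt_le_trans r1.
have r2 : 0 < r ^+ 2 by rewrite exprn_gt0.
rewrite laplacian_identity ?gt_eqF//= pE qE.
set rho := (x ^+ 2 + y ^+ 2) / r ^+ 2; set beta := y ^+ 2 / r ^+ 2 * rho.
have x2 := sqr_ge0 x; have y2 := sqr_ge0 y.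
have rho0 : 0 <= rho by rewrite divr_ge0 ?addr_ge0// ltW.
have rho1 : rho <= 1.
  by rewrite ler_pdivrMr// mul1r rxy -addrA lerDr.
have y0 : 0 <= y ^+ 2 / r ^+ 2 by rewrite divr_ge0// ltW.
have y1 : y ^+ 2 / r ^+ 2 <= 1.
  by rewrite ler_pdivrMr// mul1r rxy lerDr addr_ge0.
have beta0 : 0 <= beta by rewrite mulr_ge0.
have beta1 : beta <= 1 by rewrite /beta mulr_ile1.
have a0 : 0 <= a by move: c0 cb ba; clear; lra.
have K0 : 0 <= K by rewrite -(pmulr_lge0 _ r2) (le_trans a0)// (le_trans aW).
have s0 : 0 <= a - 4 * b + 4 * c.
  by rewrite -(pmulr_rge0 _ (lt_le_trans ltr01 M1)) (le_trans a0)// (le_trans aW).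
set s := a + (6 * a - 24 * b + 20 * c - (3 * a - 4 * b)) / 2.
have sE : s = 5 / 2 * (a - 4 * b + 4 * c) by rewrite /s; field.
have sM : a <= M * s.
  rewrite (le_trans aW)// (le_trans WM)// ler_wpM2l ?(le_trans ler01)// sE.
  by move: s0; clear; lra.
have H1 := main_term M1 a0 sM beta0 beta1.
have H2 : - (13 * a) * a <= a * (rho * (6 * a - 24 * b + 20 * c) / 2 +
    (3 * a - 4 * b) * (1 - rho / 2)) - rho * (3 * a - 4 * b) ^+ 2 / 4.
  by apply: error_term => //; move: c0 cb ba; clear; lra.
have H3 : a / r ^+ 2 <= K by rewrite ler_pdivrMr// (le_trans aW).
have H5 : - (13 * a) * K <= (a * (rho * (6 * a - 24 * b + 20 * c) / 2 +
    (3 * a - 4 * b) * (1 - rho / 2)) - rho * (3 * a - 4 * b) ^+ 2 / 4) / r ^+ 2.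
  apply: (@le_trans _ _ (- (13 * a) * a / r ^+ 2)).
    rewrite !mulNr lerN2 -[leLHS]mulrA ler_wpM2l// mulr_ge0//.
  by rewrite ler_wpM2r// invr_ge0 ltW.
rewrite CE [M * (13 * K + 1)]mulrC -[X in _ <= X + _]mulrA.
apply: (@le_trans _ _ ((13 * K + 1) * a + - (13 * a) * K)).
  by rewrite le_eqVlt; apply/orP; left; apply/eqP; ring.
refine (lerD _ H5); apply: ler_wpM2l H1.
by clear -K0; lra.
Qed.

End laplacian_bound.

(** * Growth of increasing subadditive functions *)

Section subadditive_growth.
Context {R : realType}.
Variable omega : R -> R.
Hypotheses (omega_ge0 : forall t, 0 <= t -> 0 <= omega t)
  (omega_incr : forall s t, 0 <= s -> s <= t -> omega s <= omega t)
  (omega_subadd : forall s t, 0 <= s -> 0 <= t -> omega (s + t) <= omega s + omega t)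
  (omega_0 : omega 0 = 0).

Lemma subadditive_natmul (n : nat) (s : R) : 0 <= s -> omega (n%:R * s) <= n%:R * omega s.
Proof.
move=> s0; elim: n => [|n IH]; first by rewrite !mul0r omega_0.
rewrite -natr1 !mulrDl !mul1r.
by apply: le_trans (omega_subadd _ s0) _; rewrite ?mulr_ge0// lerD2r.
Qed.

(** With n the integer part of t / s, t is at most (n + 1) s and n + 1 is at most 1 + t / s. *)
Lemma subadditive_growth (s t : R) : 0 < s -> 0 <= t ->
  omega t <= (1 + t / s) * omega s.
Proof.
move=> s0 t0; have ts0 : 0 <= t / s by rewrite divr_ge0// ltW.
have /andP[n1 n2] := truncn_itv ts0; set n := Num.truncn (t / s) in n1 n2.
apply: (@le_trans _ _ (omega (n.+1%:R * s))).
  by apply: omega_incr => //; rewrite -ler_pdivrMr// ltW.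
apply: (le_trans (subadditive_natmul _ (ltW s0))).
by rewrite ler_wpM2r ?omega_ge0 ?(ltW s0)// -natr1 addrC lerD2l.
Qed.

End subadditive_growth.

(** * The smoothed weight and the potential *)

Section potential.
Context {R : realType}.
Variable w : R -> R.
Hypotheses (mw : measurable_fun (`[0, +oo[%classic : set R) w)
  (w_ge0 : forall t, 0 <= t -> 0 <= w t)
  (w_incr : forall s t, 0 <= s -> s <= t -> w s <= w t)
  (w_growth : forall s t, 0 < s -> 0 <= t -> w t <= (1 + t / s) ^+ 2 * w s)
  (w1_gt0 : 0 < w 1).

Local Notation I := (kernel_int w).

(** A scale-invariant average of [w] around [r], against a kernel of total mass 1/3. The parameter
    [r] enters only through the kernel, so the average is smooth whatever the regularity of [w]. *)
Definition smooth_weight (r : R) : R := r ^+ 3 * I 4 r.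

Let T1 (r : R) := 3 * r ^+ 2 * I 4 r - 4 * r ^+ 3 * I 5 r.
Let T2 (r : R) := 6 * r * I 4 r - 24 * r ^+ 2 * I 5 r + 20 * r ^+ 3 * I 6 r.

Let DI n (r : R) : 0 < r -> is_derive r 1 (I n.+4) (- n.+4%:R * I n.+4.+1 r).
Proof. exact: is_derive_kernel_int. Qed.

Let is_derive_powI m n (r : R) : 0 < r ->
  is_derive r 1 (fun s => s ^+ m * I n.+4 s)
    (m%:R * r ^+ m.-1 * I n.+4 r - n.+4%:R * r ^+ m * I n.+4.+1 r).
Proof.
move=> r0.
have DX : is_derive r 1 (fun s : R => s ^+ m) (m%:R * r ^+ m.-1 *: 1).
  by apply: DeriveDef; [exact: exprn_derivable|exact: exp_derive].
apply: is_derive_eq (is_deriveM DX (DI n r0)) _.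
have alg (a b c d e : R) : a * (- b * c) + d * (e * 1) = e * d - b * a * c by ring.
exact: alg.
Qed.

Let DT (r : R) : 0 < r -> is_derive r 1 smooth_weight (T1 r).
Proof. by move=> r0; exact (is_derive_powI 3 0 r0). Qed.

Let DT1 (r : R) : 0 < r -> is_derive r 1 T1 (T2 r).
Proof.
move=> r0.
have D4 := is_deriveM (is_derive_cst (3 : R) r 1) (is_derive_powI 2 0 r0).
have D5 := is_deriveM (is_derive_cst (4 : R) r 1) (is_derive_powI 3 1 r0).
have E : T1 = cst 3 * (fun s => s ^+ 2 * I 4 s) - cst 4 * (fun s => s ^+ 3 * I 5 s).
  by apply/funext => s; rewrite /T1 -[3 * _ * _]mulrA -[4 * _ * _]mulrA.
rewrite E; apply: is_derive_eq (is_deriveB D4 D5) _.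
have alg (a b i j k : R) : 3 * (2 * r ^+ 1 * i - 4 * a * j) + b * 0 -
    (4 * (3 * r ^+ 2 * j - 5 * r ^+ 3 * k) + (r ^+ 3 * j) * 0) =
    6 * r * i - (4 * 3 * a + 4 * 3 * r ^+ 2) * j + 20 * r ^+ 3 * k by ring.
rewrite /T2 (_ : 24 * r ^+ 2 = 4 * 3 * r ^+ 2 + 4 * 3 * r ^+ 2); last by ring.
exact: alg.
Qed.

Lemma smooth_weight_le (r : R) : 0 < r -> smooth_weight r <= w r.
Proof. exact: kernel_int4_le. Qed.

Lemma Ck_smooth_weight_jbr k : Ck k (fun z : R * R => smooth_weight (jbr z)).
Proof.
apply: Ck_mul; first by apply: Ck_exp; exact: Ck_jbr.
apply: (@Ck_comp _ k jbr (fun n => I n.+4) (fun n => - n.+4%:R) 0) => //.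
- exact: jbr_gt0.
- exact: Ck_jbr.
Qed.

(** The powers of [r] put the three integrals on the same scale: they become comparable by
    [kernel_intS], and r T', r^2 T'' are combinations of them with constant coefficients. *)
Let a r := smooth_weight r.
Let b (r : R) := r ^+ 4 * I 5 r.
Let c (r : R) := r ^+ 5 * I 6 r.

Let c_ge0 (r : R) : 0 < r -> 0 <= c r.
Proof. by move=> r0; rewrite mulr_ge0 ?exprn_ge0 ?kernel_int_ge0// ltW. Qed.

Let c_le_b (r : R) : 0 < r -> c r <= b r.
Proof.
move=> r0; rewrite /c /b exprSr -mulrA ler_wpM2l ?exprn_ge0 ?(ltW r0)//.
exact: (kernel_intS mw w_ge0 w_growth 1 r0).
Qed.

Let b_le_a (r : R) : 0 < r -> b r <= a r.
Proof.
move=> r0; rewrite /b /a /smooth_weight exprSr -mulrA ler_wpM2l ?exprn_ge0 ?(ltW r0)//.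
exact: (kernel_intS mw w_ge0 w_growth 0 r0).
Qed.

Let abc_ge (r : R) : 0 < r -> w r <= 4096 * (a r - 4 * b r + 4 * c r).
Proof.
move=> r0; have := kernel_int_combination mw w_ge0 w_incr w_growth r0.
rewrite ler_pdivrMr ?ltr0n// [_ * 4096]mulrC => /le_trans; apply.
rewrite le_eqVlt; apply/orP; left; apply/eqP; congr (_ * _).
by rewrite /a /b /c /smooth_weight; ring.
Qed.

Lemma le_smooth_weight (r : R) : 0 < r -> w r <= 4096 * smooth_weight r.
Proof.
move=> r0; apply: le_trans (abc_ge r0) _; rewrite ler_wpM2l ?ler0n//.
by have := c_le_b r0; rewrite /a; lra.
Qed.

Lemma weight_gt0 (r : R) : 1 <= r -> 0 < w r.
Proof. by move=> r1; apply: lt_le_trans w1_gt0 _; exact: w_incr. Qed.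

Lemma smooth_weight_gt0 (r : R) : 1 <= r -> 0 < smooth_weight r.
Proof.
move=> r1; rewrite -(pmulr_rgt0 _ (ltr0n R 4096)).
apply: lt_le_trans (weight_gt0 r1) _; apply: le_smooth_weight.
exact: lt_le_trans r1.
Qed.

(** The value M (13 K + 1) of [laplacian_lower_bound]: M = 4096 comes from the kernel lower bound,
    and K = 4 w(1) from w r <= (1 + r)^2 w(1) <= 4 r^2 w(1) for r >= 1. *)
Definition potential_coef : R := 4096 * (13 * (4 * w 1) + 1).

Local Notation C := potential_coef.

Lemma potential_coef_ge1 : 1 <= C.
Proof.
have h : 1 <= 13 * (4 * w 1) + 1 by rewrite lerDr !mulr_ge0// ltW.
rewrite /potential_coef; apply: (le_trans h).
by rewrite ler_peMl ?(le_trans ler01 h)// ler1n.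
Qed.

Definition potential_sqr (z : R * R) : R := radG smooth_weight C z.

Definition potential (z : R * R) : R := Num.sqrt (potential_sqr z).

Lemma potential_sqr_gt0 z : 0 < potential_sqr z.
Proof.
rewrite ltr_wpDr ?smooth_weight_gt0 ?jbr_ge1// mulr_ge0 ?sqr_ge0//.
exact: le_trans ler01 potential_coef_ge1.
Qed.

Lemma Ck_potential k : Ck k potential.
Proof.
apply: Ck_sqrt; first exact: potential_sqr_gt0.
apply: Ck_add; first exact: Ck_smooth_weight_jbr.
by apply: Ck_mul; [exact: Ck_cst|apply: Ck_exp; exact: Ck_snd].
Qed.

Lemma lapl_potential_ge z :
  smooth_weight (jbr z) / potential z ^+ 3 <= lapl potential z.
Proof.
have D1 v x := is_derive_radG v C DT x; have D2 v x := is_derive_radGv v C DT1 x.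
have Du v x : is_derive x v potential
    (radGv v T1 C x / (2 * potential x)).
  exact: is_derive_sqrt_fun (potential_sqr_gt0 x) (D1 v x).
have Duu v : 'D_v (fun x => radGv v T1 C x / (2 * potential x)) z =
    (radGvv v T1 T2 C z * potential_sqr z / 2 - radGv v T1 C z ^+ 2 / 4) /
    potential z ^+ 3.
  apply: derive_val; apply: is_derive_sqrt_fun2 => //; exact: potential_sqr_gt0.
rewrite /lapl (dx_is_derive (Du (1, 0))) (dy_is_derive (Du (0, 1))).
rewrite /dx /dy !Duu -mulrDl ler_wpM2r ?invr_ge0 ?exprn_ge0 ?sqrtr_ge0//.
have r0 := jbr_gt0 z; have r1 := jbr_ge1 z.
have H := @laplacian_lower_bound R (jbr z) z.1 z.2 (a (jbr z)) (b (jbr z)) (c (jbr z))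
  (T1 (jbr z)) (T2 (jbr z)) (w (jbr z)) (4 * w 1) C 4096 r1 (sqr_jbr z)
  (c_ge0 r0) (c_le_b r0) (b_le_a r0) _ _ _ (smooth_weight_le r0) (abc_ge r0) _ erefl.
have p1 : jbr z * T1 (jbr z) = 3 * a (jbr z) - 4 * b (jbr z).
  by rewrite /T1 /a /b /smooth_weight; ring.
have p2 : jbr z ^+ 2 * T2 (jbr z) = 6 * a (jbr z) - 24 * b (jbr z) + 20 * c (jbr z).
  by rewrite /T2 /a /b /c /smooth_weight; ring.
have p3 : (1 : R) <= 4096 by rewrite ler1n.
have p4 : w (jbr z) <= 4 * w 1 * jbr z ^+ 2.
  apply: le_trans (w_growth ltr01 (ltW r0)) _.
  rewrite [leRHS]mulrAC ler_wpM2r ?w_ge0//.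
  rewrite divr1 (_ : 4 * _ = (2 * jbr z) ^+ 2); last by ring.
  by rewrite lerXn2r ?nnegrE; lra.
apply: le_trans (H p1 p2 p3 p4) _; rewrite le_eqVlt; apply/orP; left; apply/eqP.
rewrite /radGv /radGvv /potential_sqr /radG /=.
by rewrite !expr0n/= !expr1n !mulr1 !mulr0 !addr0 !add0r.
Qed.

End potential.

(** * Comparison of the modulus with the bracket, and the theorem *)

Lemma cmod_ge0 (R : realType) (z : R * R) : 0 <= cmod z.
Proof. exact: sqrtr_ge0. Qed.

Lemma cmod_le_jbr (R : realType) (z : R * R) : cmod z <= jbr z.
Proof. by rewrite ler_wsqrtr// lerD2r lerDr. Qed.

Lemma jbr_le_cmod (R : realType) (z : R * R) : jbr z <= cmod z + 1.
Proof.
have c0 := cmod_ge0 z; rewrite -(@ler_pXn2r _ 2) ?nnegrE ?addr_ge0 ?(ltW (jbr_gt0 z))//.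
rewrite sqr_jbr sqrrD expr1n sqr_sqrtr ?addr_ge0 ?sqr_ge0//.
by move: c0; rewrite mulr1 mulr2n; lra.
Qed.

Theorem lemma8 (R : realType) (omega : R -> R)
    (omega_ge0 : forall t, 0 <= t -> 0 <= omega t)
    (omega_cont : {within `[0, +oo[, continuous omega})
    (omega_incr : forall s t, 0 <= s -> s <= t -> omega s <= omega t)
    (omega_subadd : forall s t, 0 <= s -> 0 <= t ->
       omega (s + t) <= omega s + omega t)
    (omega_0 : omega 0 = 0)
    (omega_log : exists2 c : R, 0 < c &
       forall t, 1 < t -> ln (1 + t) <= c * omega t)
    (omega_int : (\int[lebesgue_measure]_(t in `[0%R, +oo[)
       (omega t / (1 + t ^+ 2))%:E < +oo)%E) :
  let p := fun z : R * R => `|z.2| + omega (cmod z) in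
  exists pt : R * R -> R,
    [/\ subharmonic (EFin \o pt),
        lesssim_on setT p pt,
        (forall delta, 0 < delta -> lesssim_on [set z | delta <= cmod z] pt p) &
        exists2 mu :
            {measure set (measurableTypeR R * measurableTypeR R) -> \bar R},
          distr_laplacian (EFin \o pt) mu &
          exists2 c : R, 0 < c &
            forall A : set (measurableTypeR R * measurableTypeR R),
              measurable A ->
              A `<=` [set z | `|z.2| <= 2 * omega (cmod z)] ->
              (\int[leb2 R]_(z in A) ((pt z)^-1)%:E <= c%:E * mu A)%E].
Proof.
move=> p.
have growth := subadditive_growth omega_ge0 omega_incr omega_subadd omega_0.
have omega_gt0 (t : R) : 0 < t -> 0 < omega t.
  move=> t0; case: omega_log => c c0 /(_ 2); rewrite ltr1n => /(_ isT) H.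
  have w2 : 0 < omega 2.
    by rewrite -(pmulr_rgt0 _ c0) (lt_le_trans _ H)// ln_gt0// ltrDl.
  have := lt_le_trans w2 (growth t 2 t0 (ler0n _ _)).
  by rewrite pmulr_rgt0// ltr_wpDr// divr_ge0// ltW.
pose w t := omega t ^+ 2.
have mw : measurable_fun (`[0, +oo[%classic : set R) w.
  apply: measurable_funX; exact: subspace_continuous_measurable_fun.
have w_ge0 t : 0 <= t -> 0 <= w t by move=> _; exact: sqr_ge0.
have w_incr s t : 0 <= s -> s <= t -> w s <= w t.
  move=> s0 st; have t0 := le_trans s0 st.
  by rewrite lerXn2r ?nnegrE ?omega_ge0 ?omega_incr.
have w_growth s t : 0 < s -> 0 <= t -> w t <= (1 + t / s) ^+ 2 * w s.
  move=> s0 t0; rewrite -exprMn lerXn2r ?nnegrE ?omega_ge0 ?growth//.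
  by rewrite mulr_ge0 ?addr_ge0 ?divr_ge0 ?omega_ge0 ?(ltW s0).
have w1 : 0 < w 1 by rewrite exprn_gt0// omega_gt0.
pose u := potential w; pose C := potential_coef w; pose T := smooth_weight w.
have C1 : 1 <= C := potential_coef_ge1 w1.
have C0 : 0 <= C := le_trans ler01 C1.
have cu k : Ck k u by exact: Ck_potential.
have lu_ge z : T (jbr z) / u z ^+ 3 <= lapl u z by exact: lapl_potential_ge.
have T_gt0 z : 0 < T (jbr z) by apply: smooth_weight_gt0 => //; exact: jbr_ge1.
have T_le z : T (jbr z) <= w (jbr z) by apply: smooth_weight_le => //; exact: jbr_gt0.
have [N N1 w_le] : exists2 N : R, 1 <= N & forall z, w (jbr z) <= N * T (jbr z).
  exists 4096 => [|z]; first by rewrite ler1n.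
  by apply: le_smooth_weight => //; exact: jbr_gt0.
have N0 : 0 <= N := le_trans ler01 N1.
have G_gt0 z : 0 < potential_sqr w z by exact: potential_sqr_gt0.
have u_gt0 z : 0 < u z by rewrite sqrtr_gt0.
have u2 z : u z ^+ 2 = T (jbr z) + C * z.2 ^+ 2 by rewrite sqr_sqrtr// ltW.
clearbody u C T.
have lu0 z : 0 <= lapl u z.
  by apply: le_trans (lu_ge z); rewrite divr_ge0 ?exprn_ge0 ?ltW.
have mlu := continuous_measurable_plane (Ck_continuous (Ck_lapl (cu 2))).
have omega_le z : omega (cmod z) <= omega (jbr z).
  by apply: omega_incr (cmod_le_jbr z); exact: cmod_ge0.
have y2 (z : R * R) : z.2 ^+ 2 <= C * z.2 ^+ 2 by rewrite ler_peMl// sqr_ge0.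
exists u; split.
- exact: subharmonic_C2 (cu 2) lu0.
- exists (1 + N) => [|z _]; first by rewrite ltr_wpDr.
  have h1 : `|z.2| <= u z.
    rewrite -(@ler_pXn2r _ 2) ?nnegrE ?(ltW (u_gt0 z))// real_normK ?num_real//.
    by rewrite u2 (le_trans (y2 z))// lerDr ltW.
  have h2 : omega (jbr z) <= N * u z.
    rewrite -(@ler_pXn2r _ 2) ?nnegrE ?mulr_ge0 ?(ltW (u_gt0 z))//; last first.
      exact/omega_ge0/ltW/jbr_gt0.
    apply: le_trans (w_le z) _; rewrite exprMn u2.
    apply: ler_pM => //; first exact/ltW/T_gt0.
      by rewrite expr2 ler_peMl.
    by rewrite lerDl mulr_ge0// sqr_ge0.
  by rewrite /p mulrDl mul1r; apply: lerD => //; exact: le_trans (omega_le z) h2.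
- move=> delta d0; have od := omega_gt0 delta d0.
  exists (1 + omega 1 / omega delta + C) => [|z /= dz].
    by rewrite ltr_wpDl ?(lt_le_trans ltr01)// addr_ge0// divr_ge0// ltW// omega_gt0.
  have c0 := cmod_ge0 z.
  have h1 : u z <= omega (jbr z) + C * `|z.2|.
    have oj : 0 <= omega (jbr z) by exact/omega_ge0/ltW/jbr_gt0.
    have Cy : 0 <= C * `|z.2| by rewrite mulr_ge0.
    rewrite -(@ler_pXn2r _ 2) ?nnegrE ?addr_ge0 ?(ltW (u_gt0 z))//.
    rewrite u2 sqrrD -addrA; apply: lerD (T_le z) _.
    apply: (@le_trans _ _ ((C * `|z.2|) ^+ 2)); last first.
      by rewrite lerDr mulrn_wge0// mulr_ge0.
    by rewrite exprMn real_normK ?num_real// ler_wpM2r ?sqr_ge0// expr2 ler_peMl.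
  have h2 : omega (jbr z) <= (1 + omega 1 / omega delta) * omega (cmod z).
    apply: (@le_trans _ _ (omega (cmod z) + omega 1)).
      apply: le_trans (omega_subadd _ _ c0 ler01).
      by apply: omega_incr (jbr_le_cmod z); exact/ltW/jbr_gt0.
    rewrite mulrDl mul1r lerD2l mulrAC ler_pdivlMr// ler_wpM2l ?omega_ge0//.
    by apply: omega_incr => //; exact: ltW.
  apply: le_trans h1 _; apply: (le_trans (lerD h2 (lexx _))).
  set B := 1 + _ / _; have B0 : 0 <= B by rewrite addr_ge0// divr_ge0 ?omega_ge0// ltW.
  have n1 : 0 <= B * `|z.2| by rewrite mulr_ge0.
  have n2 : 0 <= C * omega (cmod z) by rewrite mulr_ge0// omega_ge0.
  by move: n1 n2; rewrite /p; clear; lra.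
- exists (density (leb2 R) lu0 mlu); first exact: distr_laplacian_C2.
  pose c := 1 + C * (4 * N).
  have c0 : 0 < c by exact: ltr_pwDl ltr01 (mulr_ge0 C0 (mulr_ge0 (ler0n R 4) N0)).
  exists c => // A mA As.
  have ptw z : A z -> (u z)^-1 <= c * lapl u z.
    move=> /As /= yz.
    have u3 : 0 < u z ^+ 3 by rewrite exprn_gt0.
    apply: (@le_trans _ _ (c * (T (jbr z) / u z ^+ 3))); last first.
      by rewrite ler_wpM2l// ltW.
    rewrite mulrA ler_pdivlMr// exprS mulKf ?gt_eqF// u2 mulrDl mul1r lerD2l.
    rewrite -mulrA ler_wpM2l// -mulrA.
    apply: (@le_trans _ _ (4 * w (jbr z))); last by rewrite ler_wpM2l ?ler0n.
    rewrite -real_normK ?num_real// (_ : 4 * w (jbr z) = (2 * omega (jbr z)) ^+ 2).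
      rewrite lerXn2r ?nnegrE ?mulr_ge0//; first exact/omega_ge0/ltW/jbr_gt0.
      by rewrite (le_trans yz)// ler_wpM2l.
    by rewrite /w; ring.
  have mEl : measurable_fun A (fun z => (lapl u z)%:E).
    by apply/measurable_EFinP; exact: measurable_funTS.
  rewrite -[X in (_ <= _ * X)%E]/(\int[leb2 R]_(z in A) (lapl u z)%:E)%E.
  rewrite -ge0_integralZl//; last 2 first.
  + by move=> z _; rewrite lee_fin.
  + by rewrite lee_fin ltW.
  apply: ge0_le_integral => //.
  + by move=> z _; rewrite lee_fin invr_ge0 ltW.
  + apply/measurable_EFinP; apply: measurable_funTS.
    apply: continuous_measurable_plane => z; apply: cvgV; first by rewrite gt_eqF.
    exact: (Ck_continuous (cu 0)).
  + by apply: measurable_funeM.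
Qed.
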